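(* Suppose that $\kappa=\theta^+$ for an infinite cardinal $\theta$. (1) If $\theta$ is regular, then $\mathrm{onto}^{++}([\kappa]^\kappa,\mathcal J^\kappa_\kappa,\theta)$ holds; (2) If $\theta$ is singular, then $\mathrm{unbounded}^{++}([\kappa]^\kappa,\mathcal J^\kappa_\kappa,\theta)$ holds.
   Context: An ideal over $\kappa$ is a nonempty family $J$ of subsets of $\kappa$ closed under subsets and finite unions; it is $\kappa$-complete if it is closed under unions of fewer than $\kappa$ of its members; $J^+:=\mathcal P(\kappa)\setminus J$. $\mathcal J^\kappa_\kappa$ is the collection of all $\kappa$-complete ideals over $\kappa$ containing all bounded subsets of $\kappa$. $[\kappa]^\kappa$ is the collection of subsets of $\kappa$ of size $\kappa$. $[\kappa]^2$ is identified with the set of pairs $(\alpha,\beta)$ with $\alpha<\beta<\kappa$. A colouring $c:[\kappa]^2\to\theta$ is upper-regressive if $c(\alpha,\beta)<\beta$ for all $\alpha<\beta<\kappa$. - $\mathrm{onto}^{++}([\kappa]^\kappa,\mathcal J^\kappa_\kappa,\theta)$: there is a colouring $c:[\kappa]^2\to\theta$ such that for every $J\in\mathcal J^\kappa_\kappa$, every $A\in[\kappa]^\kappa$ and every sequence $\langle B_\tau\mid\tau<\theta\rangle$ of elements of $J^+$ there is $\eta\in A$ such that $\{\beta\in B_\tau\setminus(\eta+1)\mid c(\eta,\beta)=\tau\}\in J^+$ for every $\tau<\theta$. - $\mathrm{unbounded}^{++}([\kappa]^\kappa,\mathcal J^\kappa_\kappa,\theta)$: there is an upper-regressive colouring $c:[\kappa]^2\to\theta$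 such that for every $J\in\mathcal J^\kappa_\kappa$, every $A\in[\kappa]^\kappa$ and every sequence $\langle B_\tau\mid\tau<\theta\rangle$ of elements of $J^+$ there are $\eta\in A$ and an injection $h:\theta\to\theta$ such that $\{\beta\in B_\tau\setminus(\eta+1)\mid c(\eta,\beta)=h(\tau)\}\in J^+$ for every $\tau<\theta$. *)

(* Defs.v *)
From mathcomp Require Import all_boot all_order.
From mathcomp Require Import all_classical.

Set Implicit Arguments.
Unset Strict Implicit.
Unset Printing Implicit Defensive.

Import Order.TTheory.
Local Open Scope order_scope.
Local Open Scope classical_set_scope.
Local Open Scope card_scope.

(* The ordinal kappa is a well-ordered type K.  As in von Neumann's encoding,
   an element a of K is identified with the ordinal [below a] of its
   predecessors, so that ordinals smaller than kappa are elements of K. *)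

Definition card_lt (T U : Type) (A : set T) (B : set U) : Prop :=
  A #<= B /\ ~ (B #<= A).

Section Ordinals.
Context {d : Order.disp_t} {K : orderType d}.
Implicit Types (a b t e : K) (f : K -> K).

Definition below a : set K := [set x | x < a].

Definition is_cardinal t : Prop :=
  forall a, a < t -> card_lt (below a) (below t).

Definition infinite_cardinal t : Prop :=
  is_cardinal t /\ infinite_set (below t).

(* kappa = t^+ : kappa is a cardinal, it is larger than t (as t is an element
   of K), and no cardinal lies strictly between t and kappa. *)
Definition is_successor_cardinal_of t : Prop :=
  (forall a, card_lt (below a) [set: K]) /\
  (forall a, is_cardinal a -> a <= t).

Definition cofinal_map e t f : Prop :=
  set_fun (below e) (below t) f /\
  (forall a, a < t -> exists2 b, b < e & a <= f b).

(* cf(t) = e *)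
Definition is_cofinality t e : Prop :=
  (exists f, cofinal_map e t f) /\
  (forall e', (exists f, cofinal_map e' t f) -> e <= e').

Definition regular_cardinal t : Prop :=
  infinite_cardinal t /\ is_cofinality t t.

Definition singular_cardinal t : Prop :=
  infinite_cardinal t /\ exists2 e, e < t & is_cofinality t e.

End Ordinals.

Section Ideals.
Context {d : Order.disp_t} {K : orderType d}.
Implicit Types (J : set (set K)) (A B : set K).

(* Properness is not required. *)
Definition is_ideal J : Prop :=
  [/\ J !=set0,
      forall A B, B `<=` A -> J A -> J B &
      forall A B, J A -> J B -> J (A `|` B)].

Definition kappa_complete J : Prop :=
  forall F : set (set K), F `<=` J -> card_lt F [set: K] ->
    J (\bigcup_(A in F) A).

(* J^+ *)
Definition positive J : set (set K) := ~` J.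

(* The collection J^kappa_kappa; bounded subsets of kappa are those with an
   upper bound in kappa. *)
Definition complete_ideals : set (set (set K)) :=
  [set J | [/\ is_ideal J, kappa_complete J &
                 forall A, has_ubound A -> J A]].

(* [kappa]^kappa *)
Definition full_size_sets : set (set K) := [set A | A #= [set: K]].

End Ideals.

Arguments complete_ideals {d} K.
Arguments full_size_sets {d} K.

Section Colourings.
Context {d : Order.disp_t} {K : orderType d}.
Implicit Types (c : K -> K -> K) (t : K).

(* c : [kappa]^2 -> t ; the values c a b with ~ (a < b) are irrelevant. *)
Definition colouring t c : Prop := forall a b, a < b -> c a b < t.

Definition upper_regressive c : Prop := forall a b, a < b -> c a b < b.

Definition onto_pp (AA : set (set K)) (JJ : set (set (set K))) t : Prop :=
  exists c, colouring t c /\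
    forall J A (B : K -> set K), JJ J -> AA A ->
      (forall tau, tau < t -> positive J (B tau)) ->
      exists2 eta, A eta &
        forall tau, tau < t ->
          positive J [set b | [/\ B tau b, eta < b & c eta b = tau]].

Definition unbounded_pp (AA : set (set K)) (JJ : set (set (set K))) t : Prop :=
  exists c, [/\ colouring t c, upper_regressive c &
    forall J A (B : K -> set K), JJ J -> AA A ->
      (forall tau, tau < t -> positive J (B tau)) ->
      exists eta, exists h : K -> K,
        [/\ A eta, set_fun (below t) (below t) h, set_inj (below t) h &
          forall tau, tau < t ->
            positive J [set b | [/\ B tau b, eta < b & c eta b = h tau]]]].

End Colourings.

(* Main.v *)
(** Any colouring witnessing (1) must, given [A] of size kappa and a colour tau,
    have all large [beta] joined in colour tau to some element of a fixed initial
    segment of [A]; completeness of the ideal and a pigeonhole on the colours then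
    give the statement for all ideals and all sequences at once.

    For theta regular, such a colouring is read off minimal walks.  As in Moore's
    theorem and its extension by Rinot and Todorcevic, the number of oscillations
    of two coherent weights along the lower trace takes arbitrarily many
    consecutive values on every rectangle, so that its 2-adic valuation takes every
    value [n].  If walks from [B] pass through [delta] at step [n], for
    stationarily many [delta] of cofinality theta, then the [n]-th step of the walk
    recovers [delta], and an Ulam partition of these [delta] into theta stationary
    sets yields theta colours.

    For theta singular, with [g : l -> theta] cofinal, take theta^+ functions
    [f beta : l -> theta] increasing modulo bounded sets and such that [f beta]
    dominates the functions indexed by a club of [beta].  Club guessing below theta
    shows that every unbounded [U] has a subset [M] larger than any prescribed
    cardinal below theta on which [f] is strictly increasing beyond a fixed bound
    [a].  The colour of [(eta, beta)] is [f beta i], where [i] is least such that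
    the index of [eta] in an injection of [beta] into theta is at most [g i].  If
    each [eta] in a set [X] of size theta received few colours from [U], then some
    [beta] in [M] would give [eta] an index below [a], so [X] would inject into
    [M * a]. *)

Require Import Defs.
From mathcomp Require Import all_boot all_order.
From mathcomp Require Import all_classical.
From mathcomp Require Import zify.
From mathcomp Require wochoice.

Set Implicit Arguments.
Unset Strict Implicit.
Unset Printing Implicit Defensive.

Import Order.TTheory.
Local Open Scope order_scope.
Local Open Scope classical_set_scope.
Local Open Scope card_scope.

(** * Cardinals below a well-ordered type *)

Lemma exists_choice {T U : Type} (P : T -> U -> Prop) :
  (forall x, exists y, P x y) -> exists f, forall x, P x (f x).
Proof. by move=> /choice[f fP]; exists f. Qed.

Lemma card_le_inj {T U : Type} (A : set T) (B : set U) (f : T -> U) :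
  (forall x, A x -> B (f x)) -> (forall x y, A x -> A y -> f x = f y -> x = y) ->
  A #<= B.
Proof.
move=> fAB finj.
suff /injfunPex[g] : exists2 f : T -> U, set_fun A B f & set_inj A f.
  exact: inj_card_le g.
by exists f => // x y /set_mem xA /set_mem yA; apply: finj.
Qed.

Lemma card_le_ex {T U : Type} (A : set T) (B : set U) (u0 : U) : A #<= B ->
  exists f : T -> U, (forall x, A x -> B (f x)) /\
    (forall x y, A x -> A y -> f x = f y -> x = y).
Proof.
elim/Ppointed: U => U in u0 B *; first by case: (no u0).
move=> /pcard_leP/injfunPex[f fAB finj]; exists f; split=> // x y Ax Ay.
by apply: finj; apply/mem_set.
Qed.

Lemma card_le_cover {T U : Type} (A : set T) (B : set U) (f : U -> T) :
  (forall x, A x -> exists2 y, B y & f y = x) -> A #<= B.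
Proof.
move=> fBA; apply: card_le_trans (card_image_le f B).
by apply: subset_card_le => x /fBA[y By <-]; exists y.
Qed.

Lemma card_le_setU1 {T : Type} (A : set T) x : infinite_set A -> A `|` [set x] #<= A.
Proof.
move=> /infiniteP; case: (pselect (A x)) => [Ax _|nAx].
  by apply: subset_card_le => y [//|->].
move=> /(card_le_ex x)[f [fA finj]].
(* Hilbert's hotel: [x] moves to [f 0], each [f n] to [f n.+1], and all other points stay. *)
pose P y z := [\/ y = x /\ z = f 0%N, y <> x /\ exists2 n, y = f n & z = f n.+1 |
  [/\ y <> x, forall n, y <> f n & z = y]].
have [h hP] : exists h, forall y, P y (h y).
  apply: (@exists_choice _ _ P) => y; have [->|yx] := pselect (y = x).
    by exists (f 0%N); constructor 1.
  have [[n yn]|nf] := pselect (exists n, y = f n).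
    by exists (f n.+1); constructor 2; split=> //; exists n.
  by exists y; constructor 3; split=> // n yn; apply: nf; exists n.
apply: (@card_le_inj _ _ _ _ h) => [y Ay|y z Ay Az].
  case: (hP y) => [[_ ->]|[_ [n _ ->]]|[yx _ ->]]; [exact: fA|exact: fA|].
  by case: Ay.
have {}finj m n : f m = f n -> m = n by apply: finj.
case: (hP y) => [[-> ->]|[_ [n -> ->]]|[_ nf ->]];
  case: (hP z) => [[-> ->]|[_ [m -> ->]]|[_ nf' ->]] //.
- by move=> /finj.
- by move=> e; case: (nf' _ (esym e)).
- by move=> /finj.
- by move=> /finj[->].
- by move=> e; case: (nf' _ (esym e)).
- by move=> /nf.
- by move=> /nf.
Qed.

Lemma card_le_neq0 {T U : Type} (A : set T) (B : set U) x : A #<= B -> A x -> exists y, B y.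
Proof.
move=> AB Ax; apply: contrapT => nB.
have B0 : B = set0 by apply/seteqP; split=> y // By; apply: nB; exists y.
by move: AB Ax; rewrite B0 card_le0 => /eqP->.
Qed.

Lemma card_le_setX {T U T' U' : Type} (A : set T) (A' : set T') (B : set U) (B' : set U') :
  A #<= A' -> B #<= B' -> A `*` B #<= A' `*` B'.
Proof.
move=> AA' BB'; have [->|/set0P[[x y] [/= Ax By]]] := eqVneq (A `*` B) set0.
  exact: card_ge0.
have [x' _] := card_le_neq0 AA' Ax; have [y' _] := card_le_neq0 BB' By.
have [f [fA fi]] := card_le_ex x' AA'; have [g [gB gi]] := card_le_ex y' BB'.
apply: (@card_le_inj _ _ _ _ (fun p => (f p.1, g p.2))) => [p [Ap Bp]|].
  by split; [exact: fA|exact: gB].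
move=> [a b] [c e] [/= Aa Bb] [/= Ac Be] [/fi fac /gi gbe].
by rewrite fac // gbe.
Qed.

Lemma wf_recursion {T U : Type} (R : T -> T -> Prop) (u0 : U)
    (F : T -> (T -> U) -> U) : well_founded R ->
  exists g, forall x, g x = F x (fun y => if `[< R y x >] then g y else u0).
Proof.
move=> wfR.
pose G x (rec : forall y, R y x -> U) :=
  F x (fun y => if pselect (R y x) is left h then rec y h else u0).
exists (Fix wfR (fun=> U) G) => x; rewrite Fix_eq; last first.
  move=> {}x f g fg; congr (F x _); apply/funext => y.
  by case: pselect.
congr (F x _); apply/funext => y.
by case: pselect => h; [rewrite (asboolT h)|rewrite (asboolF h)].
Qed.

Section WellOrder.
Context {d : Order.disp_t} {K : orderType d}.
Context (hK : wochoice.well_order (@Order.le d K)).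
Implicit Types (a b x y z : K) (A D R : set K).

Lemma ex_least (P : set K) : (exists x, P x) ->
  exists2 x, P x & forall y, P y -> x <= y.
Proof.
case=> x Px; have [|z [[/asboolP Pz zP] _]] := hK (A := fun x => `[< P x >]).
  by exists x; apply/asboolP.
by exists z => // y Py; apply: zP; apply/asboolP.
Qed.

Lemma wo_ind (P : K -> Prop) : (forall x, (forall y, y < x -> P y) -> P x) ->
  forall x, P x.
Proof.
move=> ind x; apply: contrapT => nPx.
have [z nPz zmin] := @ex_least (~` (P : set K)) (ex_intro _ x nPx).
apply: nPz; apply: ind => y yz; apply: contrapT => /zmin.
by rewrite leNgt yz.
Qed.

Lemma wf_lt : well_founded (fun x y : K => x < y).
Proof. by apply: wo_ind => x IH; constructor. Qed.

Definition least (x0 : K) (P : set K) : K :=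
  xget x0 [set x | P x /\ forall y, P y -> x <= y].

Lemma leastP x0 (P : set K) : (exists x, P x) -> P (least x0 P).
Proof. by move=> /ex_least[x Px xP]; rewrite /least; case: xgetP => [y _ []|/(_ x)[]]. Qed.

Lemma least_le x0 (P : set K) x : P x -> least x0 P <= x.
Proof.
move=> Px; rewrite /least; case: xgetP => [y _ [_]|]; first exact.
by have [|z Pz zP /(_ z)[]//] := @ex_least P; exists x.
Qed.

Lemma greedy {T : Type} (R : T -> T -> Prop) (D : set T) (V : T -> set K) (x0 : K) :
  well_founded R -> (forall x y : T, x <> y -> R x y \/ R y x) ->
  (forall x : T, D x -> ~ (V x #<= [set y | D y /\ R y x])) ->
  exists h : T -> K, (forall x : T, D x -> V x (h x)) /\
    (forall x y : T, D x -> D y -> h x = h y -> x = y).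
Proof.
move=> wfR totR VD.
pose F (x : T) (g : T -> K) :=
  xget x0 [set v | V x v /\ forall y : T, D y -> R y x -> g y <> v].
have [h hE] := wf_recursion x0 F wfR.
have hP (x : T) : D x -> V x (h x) /\ forall y : T, D y -> R y x -> h y <> h x.
  move=> Dx.
  suff : exists v, V x v /\ forall y : T, D y -> R y x -> h y <> v.
    move=> ex; rewrite [h x]hE /F; case: xgetP => [v _ [Vv vy]|]; last first.
      move=> no; case: ex => v [Vv vy]; case: (no v); split=> // y Dy Ryx.
      by rewrite (asboolT Ryx); apply: vy.
    by split=> // y Dy Ryx; have := vy y Dy Ryx; rewrite (asboolT Ryx).
  apply: contrapT => nex; apply: (VD x Dx).
  apply: (@card_le_cover _ _ _ _ h) => v Vv; apply: contrapT => nv.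
  by apply: nex; exists v; split=> // y Dy Ryx hy; apply: nv; exists y.
exists h; split=> [x /hP[]//|x y Dx Dy hxy].
apply: contrapT => /totR[Rxy|Ryx].
  by case: (hP y Dy) => _ /(_ x Dx Rxy).
by case: (hP x Dx) => _ /(_ y Dy Ryx); rewrite hxy.
Qed.

Definition upto a : set K := [set x | x <= a].

Lemma uptoE a : upto a = below a `|` [set a].
Proof.
apply/seteqP; split=> x /=; rewrite /upto /below /= le_eqVlt.
  by case/orP => [/eqP|]; [right|left].
by case=> [->|->]; rewrite ?eqxx ?orbT.
Qed.

Lemma below_mono a b : a <= b -> below a #<= below b.
Proof. by move=> ab; apply: subset_card_le => x xa; apply: lt_le_trans ab. Qed.

Lemma infinite_below a b : a <= b -> infinite_set (below a) -> infinite_set (below b).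
Proof. by move=> /below_mono ab ia /(card_le_finite ab). Qed.

Lemma card_upto a : infinite_set (below a) -> upto a #<= below a.
Proof. by rewrite uptoE; apply: card_le_setU1. Qed.

Lemma finite_upto a : finite_set (below a) -> finite_set (upto a).
Proof. by rewrite uptoE => fa; rewrite finite_setU; split=> //; apply: finite_set1. Qed.

Lemma card_upto_le x a : infinite_set (below a) -> below x #<= below a ->
  upto x #<= below a.
Proof.
move=> ia xa; have [fx|ix] := pselect (finite_set (below x)); last first.
  exact: card_le_trans (card_upto ix) xa.
apply: card_le_trans _ (iffLR (infiniteP _) ia).
exact: finite_set_countable (finite_upto fx).
Qed.

(** Goedel's ordering of pairs: the predecessors of [p] lie in the square of [upto m], with [m] the
    larger coordinate of [p]. *)
Definition max_lex (p q : K * K) : Prop :=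
  let mp := Order.max p.1 p.2 in let mq := Order.max q.1 q.2 in
  mp < mq \/ mp = mq /\ (p.1 < q.1 \/ p.1 = q.1 /\ p.2 < q.2).

Lemma wf_max_lex : well_founded max_lex.
Proof.
suff : forall m x y (p : K * K), Order.max p.1 p.2 = m -> p.1 = x -> p.2 = y ->
    Acc max_lex p by move=> H p; apply: H.
move=> m; elim/wo_ind: m => m IHm x; elim/wo_ind: x => x IHx y.
elim/wo_ind: y => y IHy p pm px py.
constructor => q [|[]].
  by rewrite pm => qm; apply: (IHm _ qm).
rewrite pm => qm [|[]]; rewrite px => qx; first exact: (IHx _ qx).
by rewrite py => qy; apply: (IHy _ qy).
Qed.

Lemma max_lex_total p q : p <> q -> max_lex p q \/ max_lex q p.
Proof.
move=> pq; rewrite /max_lex.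
case: (ltgtP (Order.max p.1 p.2) (Order.max q.1 q.2)) => [h|h|m].
- by left; left.
- by right; left.
case: (ltgtP p.1 q.1) => [h|h|p1].
- by left; right; split=> //; left.
- by right; right; split=> //; left.

case: (ltgtP p.2 q.2) => [h|h|p2].
- by left; right; split=> //; right.
- by right; right; split=> //; right.
by case: pq; apply/eqP; rewrite -pair_eqE /pair_eq p1 p2 !eqxx.
Qed.

(** Hessenberg's theorem. If some smaller [b] has the same cardinality, the induction hypothesis for
    [b] suffices. Otherwise [greedy] along [max_lex] applies, since the predecessors of a pair lie
    in the square of some [upto m] with [m < a], which is smaller than [below a]. *)
Lemma card_sqr a : infinite_set (below a) -> below a `*` below a #<= below a.
Proof.
elim/wo_ind: a => a IH ia.
have [[b ba ab]|nb] := pselect (exists2 b, b < a & below a #<= below b).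
  apply: card_le_trans (card_le_setX ab ab) _.
  apply: card_le_trans (IH b ba _) (below_mono (ltW ba)).
  by move=> /(card_le_finite ab).
have [x0 _] := infinite_setN0 ia.
have [|h [ha hi]] := greedy (D := below a `*` below a) (V := fun=> below a) x0
  wf_max_lex max_lex_total; last exact: card_le_inj ha hi.
move=> p [/= p1 p2] le; set m := Order.max p.1 p.2; have ma : m < a by rewrite gt_max p1 p2.
  have {}le : below a #<= upto m `*` upto m.
    apply: card_le_trans le _; apply: subset_card_le => -[x y] /= [_ xy].
    have : Order.max x y <= m by case: xy => [/ltW|[/= -> _]].
    by rewrite ge_max => /andP[].
  have [fm|im] := pselect (finite_set (below m)).
    by apply: ia; apply: card_le_finite le _; apply: finite_setX; apply: finite_upto.
  apply: nb; exists m => //; apply: card_le_trans le _.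
  exact: card_le_trans (card_le_setX (card_upto im) (card_upto im)) (IH m ma im).
Qed.

Lemma card_setX_le {T U : Type} (A : set T) (B : set U) a : infinite_set (below a) ->
  A #<= below a -> B #<= below a -> A `*` B #<= below a.
Proof. by move=> ia Aa Ba; apply: card_le_trans (card_le_setX Aa Ba) (card_sqr ia). Qed.

Lemma card_bigcup_le {T I : Type} (D : set I) (F : I -> set T) a :
  infinite_set (below a) -> D #<= below a ->
  (forall i, D i -> F i #<= below a) -> \bigcup_(i in D) F i #<= below a.
Proof.
move=> ia Da Fa; have [f [fD fi]] := card_le_ex a Da.
have /exists_choice[g gP] : forall i, exists gi : T -> K, D i ->
    (forall x : T, F i x -> below a (gi x)) /\
    (forall x y : T, F i x -> F i y -> gi x = gi y -> x = y).
  move=> i; have [Di|nDi] := pselect (D i); last by exists (fun=> a).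
  by have [gi giP] := card_le_ex a (Fa i Di); exists gi.
have [->|/set0P[x0 [i0 _ _]]] := eqVneq (\bigcup_(i in D) F i) set0.
  exact: card_ge0.
have /exists_choice[s sP] : forall x : T, exists i, (\bigcup_(i in D) F i) x ->
    D i /\ F i x.
  move=> x; have [[i Di Fx]|nx] := pselect ((\bigcup_(i in D) F i) x).
    by exists i.
  by exists i0 => /nx.
apply: card_le_trans _ (card_sqr ia).
apply: (@card_le_inj _ _ _ _ (fun x : T => (f (s x), g (s x) x))) => [x /sP[Ds Fs]|].
  by split; [exact: fD|apply: (gP _ Ds).1].
move=> x y /sP[Dx Fx] /sP[Dy Fy] [/fi sxy gxy].
move: gxy Fy; rewrite -sxy // => gxy Fy.
exact: (gP _ Dx).2 gxy.
Qed.

Definition initial R := forall x y, R x -> y <= x -> R y.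

Definition cof_gt a R := forall D, D `<=` R -> D #<= below a ->
  exists2 b, R b & forall x, D x -> x < b.

(** A cofinal [D] of size at most [a] would cover [R] by at most [a] segments [upto x], each of size
    at most [a]. *)
Lemma cof_gt_succ R a : infinite_set (below a) -> initial R ->
  (forall x, R x -> below x #<= below a) -> ~ (R #<= below a) -> cof_gt a R.
Proof.
move=> ia iR Ra nRa D DR Da; apply: contrapT => nb; apply: nRa.
apply: card_le_trans _ (card_bigcup_le (F := upto) ia Da _); last first.
  by move=> x /DR/Ra; apply: card_upto_le.
apply: subset_card_le => b Rb; apply: contrapT => nbD.
apply: nb; exists b => // x Dx; rewrite ltNge; apply/negP => bx.
by apply: nbD; exists x.
Qed.
End WellOrder.

(** * Recursion along the order and closure points of functions *)

Section Recursion.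
Context {d : Order.disp_t} {K : orderType d}.
Context (hK : wochoice.well_order (@Order.le d K)).
Implicit Types (a b x y z : K) (A D R : set K).

Lemma lt_recursion {U : Type} (u0 : U) (G : K -> (K -> U) -> U) :
  (forall x g h, (forall y, y < x -> g y = h y) -> G x g = G x h) ->
  exists g, forall x, g x = G x g.
Proof.
move=> Gloc; have [g gE] := wf_recursion u0 G (wf_lt hK).
by exists g => x; rewrite [LHS]gE; apply: Gloc => y yx; rewrite asboolT.
Qed.

Lemma eq_least x0 A D : (forall x, A x <-> D x) -> least x0 A = least x0 D.
Proof. by move=> AD; congr least; apply/seteqP; split=> x /AD. Qed.

(** The point [z] is the supremum of an increasing sequence [p] of length [a], each step of which
    closes off under [F]. Recording [p] gives control over the cofinality of [z]. *)
Lemma closure_point R a (F : K -> K) y : initial R ->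
  (forall x, R x -> exists2 x', R x' & x < x') ->
  (forall b, R b -> cof_gt b R) -> cof_gt a R ->
  (forall j, j < a -> exists2 j', j' < a & j < j') ->
  (exists j, j < a) ->
  (forall x, R x -> R (F x)) -> R y ->
  exists z (p : K -> K), [/\ R z, y < z, forall x, x < z -> F x < z &
    [/\ forall j, j < a -> p j < z, forall i j, i < j -> j < a -> p i < p j &
       forall x, x < z -> exists2 j, j < a & x < p j]].
Proof.
move=> iR nomax regR aR lima [j0 j0a] FR Ry.
have /exists_choice[F' F'P] : forall x, exists x', R x -> [/\ R x', x < x' &
    forall y, y <= x -> F y < x'].
  move=> x; have [Rx|nRx] := pselect (R x); last by exists x.
  have [x1 Rx1 xx1] := nomax x Rx.
  have [||b Rb bP] := regR x1 Rx1 (F @` upto x).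
  - by move=> _ [u /= ux <-]; apply: FR; apply: iR Rx ux.
  - apply: card_le_trans (card_image_le _ _) _; apply: subset_card_le => u /= ux.
    exact: le_lt_trans xx1.
  exists (Order.max b x1) => _; split.
  - by rewrite /Order.max; case: ifP.
  - by rewrite lt_max xx1 orbT.
  - by move=> u ux; rewrite lt_max bP//; exists u.
pose G j (p : K -> K) := least y [set z | [/\ R z, y < z & forall i, i < j -> F' (p i) < z]].
have [j g h gh|p pE] := lt_recursion y (G := G).
  by apply: eq_least => x; split=> -[Rx yx xP]; split=> // i ij; move: (xP i ij); rewrite gh.
have {pE} pP j : j < a -> [/\ R (p j), y < p j & forall i, i < j -> F' (p i) < p j].
  elim/(wo_ind hK): j => j IH ja; rewrite pE.
  have [||b Rb bP] := aR ((F' \o p) @` below j).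
  - move=> _ [i /= ij <-]; have [Rpi _ _] := IH i ij (lt_trans ij ja).
    by have [] := F'P _ Rpi.
  - exact: card_le_trans (card_image_le _ _) (below_mono (ltW ja)).
  have [y' Ry' yy'] := nomax y Ry.
  apply: (leastP hK y (P := [set z | [/\ R z, y < z & forall i, i < j -> F' (p i) < z]])).
  exists (Order.max b y'); split.
  - by rewrite /Order.max; case: ifP.
  - by rewrite lt_max yy' orbT.
  - by move=> i ij; rewrite lt_max bP//; exists i.
have [||b Rb bP] := aR (p @` below a).
- by move=> _ [i /= /pP[Ri _ _] <-].
- exact: card_image_le.
have pinc i j : i < j -> j < a -> [/\ p i < p j & forall u, u <= p i -> F u < p j].
  move=> ij ja; have [Rj _ /(_ i ij) Fj] := pP j ja.
  have [Ri _ _] := pP i (lt_trans ij ja).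
  have [_ h1 h2] := F'P _ Ri; split; first exact: lt_trans h1 Fj.
  by move=> u /h2 h3; exact: lt_trans h3 Fj.
pose Z := [set z | R z /\ forall j, j < a -> p j < z].
have Zne : exists z, Z z by exists b; split=> // j ja; apply: bP; exists j.
have [Rz zP] := leastP hK y Zne; set z := least y Z in Rz zP *.
have zsup x : x < z -> exists2 j, j < a & x < p j.
  move=> xz; apply: contrapT => nx.
  suff : z <= x by rewrite leNgt xz.
  apply: (least_le hK); split; first exact: iR Rz (ltW xz).
  move=> j ja; have [j' j'a jj'] := lima j ja.
  rewrite ltNge; apply/negP => xpj; apply: nx; exists j' => //.
  by apply: le_lt_trans xpj _; case: (pinc _ _ jj' j'a).
exists z, p; split=> //.
- by have [_ yp _] := pP j0 j0a; apply: lt_trans yp (zP _ j0a).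
- move=> x /zsup[j ja xj]; have [j' j'a jj'] := lima j ja.
  by apply: lt_trans (zP j' j'a); case: (pinc _ _ jj' j'a) => _; apply; apply: ltW.
- by split=> // i j ij ja; case: (pinc i j ij ja).
Qed.
End Recursion.

(** * Subsets of a successor cardinal *)

Section Successor.
Context {d : Order.disp_t} {K : orderType d} {theta : K}.
Context (hK : wochoice.well_order (@Order.le d K)).
Context (htheta : infinite_cardinal theta) (hsucc : is_successor_cardinal_of theta).
Implicit Types (a b x y z : K) (A D R : set K).

Lemma cardinal_nle a : a < theta -> ~ (below theta #<= below a).
Proof. by case: htheta => h _ /h[]. Qed.

(** The least [c] violating this would be a cardinal, hence at most [theta] by the definition of
    successor, and then [below c] embeds in [below theta]. *)
Lemma below_le x : below x #<= below theta.
Proof.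
apply: contrapT => nx.
have [c nc cP] := ex_least hK (P := fun x => ~ (below x #<= below theta)) (ex_intro _ x nx).
have : is_cardinal c.
  move=> y yc; split; first exact: below_mono (ltW yc).
  move=> cy; apply: nc; apply: card_le_trans cy _; apply: contrapT => /cP.
  by rewrite leNgt yc.
by case: hsucc => _ /[apply] ct; apply: nc; apply: below_mono.
Qed.

Lemma setT_nle : ~ ([set: K] #<= below theta).
Proof. by case: hsucc => /(_ theta)[]. Qed.

Lemma kappa_regular : cof_gt theta [set: K].
Proof.
apply: (cof_gt_succ hK htheta.2) => // [x _|]; first exact: below_le.
exact: setT_nle.
Qed.

Lemma kappa_regular_le b : cof_gt b [set: K].
Proof. by move=> D DT Db; apply: kappa_regular => //; apply: card_le_trans Db (below_le b). Qed.

Lemma kappa_bound {I : Type} (D : set I) (F : I -> K) :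
  D #<= below theta -> exists b, forall i, D i -> F i < b.
Proof.
move=> Dt; have [//||b _ bP] := @kappa_regular (F @` D).
  exact: card_le_trans (card_image_le _ _) Dt.
by exists b => i Di; apply: bP; exists i.
Qed.

Lemma kappa_nomax x : exists y, x < y.
Proof.
have [|y yP] := kappa_bound (D := [set x]) id; last by exists y; apply: yP.
apply: card_le_trans _ (iffLR (infiniteP _) htheta.2).
exact: finite_set_countable (finite_set1 _).
Qed.

Definition unbounded A := forall x, exists2 y, A y & x < y.

Lemma unbounded_nle A : unbounded A -> ~ (A #<= below theta).
Proof.
move=> uA At; have [b bP] := kappa_bound id At.
by have [y /bP yb by_] := uA b; have := lt_trans yb by_; rewrite ltxx.
Qed.

Lemma nle_unbounded A : ~ (A #<= below theta) -> unbounded A.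
Proof.
move=> nA x; apply: contrapT => nx; apply: nA.
apply: card_le_trans _ (card_upto_le htheta.2 (below_le x)).
apply: subset_card_le => y Ay ; rewrite /upto /= leNgt; apply/negP => xy.
by apply: nx; exists y.
Qed.

Lemma full_size_unbounded A : full_size_sets K A -> unbounded A.
Proof.
move=> /card_esym /card_eqPle[TA _]; apply: nle_unbounded => At.
by apply: setT_nle; apply: card_le_trans TA At.
Qed.

Lemma unbounded_pigeonhole {I : Type} (D : set I) (F : I -> set K) A :
  unbounded A -> D #<= below theta -> A `<=` \bigcup_(i in D) F i ->
  exists2 i, D i & unbounded (A `&` F i).
Proof.
move=> uA Dt AF; apply: contrapT => no.
have /exists_choice[b bP] : forall i, exists b, D i -> forall y, A y -> F i y -> y <= b.
  move=> i; have [Di|nDi] := pselect (D i); last by exists theta.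
  apply: contrapT => nb; apply: no; exists i => // x; apply: contrapT => nx.
  apply: nb; exists x => _ y Ay Fy; rewrite leNgt; apply/negP => xy.
  by apply: nx; exists y.
have [c cP] := kappa_bound b Dt; have [y Ay cy] := uA c.
have [i Di Fy] := AF y Ay.
by have := lt_le_trans (lt_trans (cP i Di) cy) (bP i Di y Ay Fy); rewrite ltxx.
Qed.

Lemma unbounded_inj A : unbounded A ->
  exists X : K -> K, (forall i, i < theta -> A (X i)) /\
    forall i j, i < theta -> j < theta -> X i = X j -> i = j.
Proof.
move=> uA; have totlt x y : x <> y -> x < y \/ y < x.
  by move=> /eqP; rewrite neq_lt => /orP.
have [|X [XA Xi]] := greedy (D := below theta) (V := fun=> A) theta (wf_lt hK) totlt; last by exists X.
move=> x xt le; apply: (unbounded_nle uA); apply: card_le_trans le _.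
by apply: subset_card_le => y [].
Qed.

Lemma theta_limit i : i < theta -> exists2 j, j < theta & i < j.
Proof.
move=> it; apply: contrapT => nj.
have eq : below theta `<=` upto i.
  by move=> j jt; rewrite /upto /= leNgt; apply/negP => ij; apply: nj; exists j.
apply: (cardinal_nle it); apply: card_le_trans (subset_card_le eq) _.
apply: card_upto => fi; apply: htheta.2.
exact: card_le_finite (subset_card_le eq) (finite_upto fi).
Qed.
End Successor.

Arguments unbounded {d K} A.

(** * From colours over initial segments to all complete ideals *)

Section IdealReduction.
Context {d : Order.disp_t} {K : orderType d} {theta : K}.
Context (hK : wochoice.well_order (@Order.le d K)).
Context (htheta : infinite_cardinal theta) (hsucc : is_successor_cardinal_of theta).
Implicit Types (A B : set K) (J : set (set K)).

Lemma ideal_bigcup {I : Type} J (D : set I) (F : I -> set K) :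
  complete_ideals K J -> D #<= below theta -> (forall i, D i -> J (F i)) ->
  J (\bigcup_(i in D) F i).
Proof.
case=> _ Jk _ Dt JF.
have -> : \bigcup_(i in D) F i = \bigcup_(A in F @` D) A by rewrite bigcup_image.
have FDt : F @` D #<= below theta by apply: card_le_trans (card_image_le _ _) Dt.
apply: Jk => [_ [i Di <-]|]; first exact: JF.
split; first exact: card_le_trans FDt (card_leT _).
by move=> TF; apply: (setT_nle hsucc); apply: card_le_trans TF FDt.
Qed.

Lemma ideal_below J e : complete_ideals K J -> J (upto e).
Proof. by case=> _ _; apply; exists e => x. Qed.

Lemma positive_unbounded J B : complete_ideals K J -> positive J B -> unbounded B.
Proof.
move=> JJ JB x; apply: contrapT => nx; apply: JB.
case: (JJ) => -[_ Jsub _] _ _; apply: Jsub (ideal_below x JJ) => y By.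
by rewrite /upto /= leNgt; apply/negP => xy; apply: nx; exists y.
Qed.

Lemma positive_avoid {I : Type} J B e (D : set I) (F : I -> set K) :
  complete_ideals K J -> positive J B -> D #<= below theta ->
  (forall i, D i -> J (F i)) ->
  positive J [set b | [/\ B b, e < b & forall i, D i -> ~ F i b]].
Proof.
move=> JJ JB Dt JF JB'; apply: JB; case: (JJ) => -[_ Jsub JU] _ _.
apply: Jsub (JU _ _ (JU _ _ JB' (ideal_below e JJ)) (ideal_bigcup JJ Dt JF)) => b Bb.
have [be|eb] := leP b e; first by left; right.
have [[i Di Fi]|nF] := pselect (exists2 i, D i & F i b).
  by right; exists i.
by left; left; split=> // i Di Fi; apply: nF; exists i.
Qed.

(** If every [eta] in [A] failed at some colour, unboundedly many would fail at the same [tau].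
    Those below [e] number at most theta, so their null fibres can be removed from [B tau] leaving a
    positive set; yet every point of [B tau] beyond [e] lies in one of these fibres. *)
Lemma onto_pp_intro c : colouring theta c ->
  (forall A tau, unbounded A -> tau < theta -> exists e, forall b, e <= b ->
     exists eta, [/\ A eta, eta < e & c eta b = tau]) ->
  onto_pp (full_size_sets K) (complete_ideals K) theta.
Proof.
move=> ct conto; exists c; split=> // J A B JJ /(full_size_unbounded hK htheta hsucc) uA posB.
apply: contrapT => nex.
pose bad tau eta := J [set b | [/\ B tau b, eta < b & c eta b = tau]].
have [|tau tt uA'] := unbounded_pigeonhole hK htheta hsucc uA (card_lexx (below theta)) (F := bad).
  move=> eta Aeta; apply: contrapT => nbad; apply: nex; exists eta => // tau tt Jb.
  by apply: nbad; exists tau.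
have [e eP] := conto _ tau uA' tt.
have [||b [Bb eb bP] _] := positive_unbounded JJ (positive_avoid (e := e)
  (D := (A `&` bad tau) `&` below e) (F := fun eta => [set b | [/\ B tau b, eta < b & c eta b = tau]]) JJ (posB tau tt) _ _) theta.
- apply: card_le_trans _ (below_le hK hsucc e); apply: subset_card_le => x [] //.
- by move=> eta [[_ ?]].
have [eta [[Aeta be] etae cb]] := eP b (ltW eb).
by apply: (bP eta) => //; split=> //; apply: lt_trans eb.
Qed.

End IdealReduction.

(** * Minimal walks *)

Section Walks.
Context {d : Order.disp_t} {K : orderType d} {theta bot : K}.
Context (hK : wochoice.well_order (@Order.le d K)).
Context (htheta : infinite_cardinal theta) (hbot : forall x, bot <= x).
Context (hreg : forall i, i < theta -> cof_gt i (below theta)).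
Implicit Types (a b x y z i j g : K) (A D : set K).

Definition small {T : Type} (D : set T) : Prop :=
  exists2 i, i < theta & D #<= below i.

Lemma bot_lt_theta : bot < theta.
Proof.
have [x xt] := infinite_setN0 htheta.2; exact: le_lt_trans (hbot x) xt.
Qed.

Lemma small_le {T U : Type} (A : set T) (B : set U) : A #<= B -> small B -> small A.
Proof. by move=> AB [i it Bi]; exists i => //; apply: card_le_trans AB Bi. Qed.

Lemma small_upto i : i < theta -> small (upto i).
Proof.
move=> it; have [j jt ij] := theta_limit htheta it; exists j => //.
by apply: subset_card_le => x xi; apply: le_lt_trans xi ij.
Qed.

Lemma small_setU1 {T : Type} (A : set T) (x : T) : small A -> small (A `|` [set x]).
Proof.
case=> i it /(card_le_ex i)[f [fA fi]].
apply: small_le (small_upto it).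
apply: (@card_le_inj _ _ _ _ (fun y : T => if `[< y = x >] then i else f y)) => [y|y z].
  by rewrite /upto /=; case: asboolP => //= yx [/fA/ltW|].
case: asboolP => [-> _|yx [Ay|//]]; case: asboolP => [-> _|zx [Az|//]] //.
- by move=> ie; move: (fA _ Az); rewrite -ie /below /= ltxx.
- by move=> ie; move: (fA _ Ay); rewrite ie /below /= ltxx.
- exact: fi.
Qed.

Lemma small_set1 {T : Type} (x : T) : small [set x].
Proof.
rewrite -[X in small X]set0U; apply: small_setU1.
by exists bot; [exact: bot_lt_theta|exact: card_ge0].
Qed.

Lemma small_II n : small `I_n.
Proof.
elim: n => [|n IH].
  apply: small_le (small_set1 0%N); rewrite II0; exact: card_ge0.
apply: small_le (small_setU1 n IH); apply: subset_card_le => k /=.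
by rewrite ltnS leq_eqVlt => /orP[/eqP|]; [right|left].
Qed.

Lemma small_finite {T : Type} (A : set T) : finite_set A -> small A.
Proof. by case=> n /card_eqPle[An _]; apply: small_le An (small_II n). Qed.

(** Regularity of theta bounds the sizes of the pieces by a single [m] below theta. Finite [m] is
    separate because [card_bigcup_le] needs an infinite one. *)
Lemma small_bigcup {T I : Type} (D : set I) (F : I -> set T) :
  small D -> (forall k, D k -> small (F k)) -> small (\bigcup_(k in D) F k).
Proof.
move=> [i it Di] Fs.
have /exists_choice[j jP] : forall k, exists j, D k -> j < theta /\ F k #<= below j.
  move=> k; have [Dk|nDk] := pselect (D k); last by exists theta.
  by have [j jt Fj] := Fs k Dk; exists j.
have [||b bt bP] := hreg it (D := j @` D).
- by move=> _ [k /jP[jt _] <-].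
- exact: card_le_trans (card_image_le _ _) Di.
set m := Order.max i b; have mt : m < theta by rewrite gt_max it bt.
have {}Di : D #<= below m.
  by apply: card_le_trans Di (below_mono _); rewrite le_max lexx.
have Fm k : D k -> F k #<= below m.
  move=> Dk; apply: card_le_trans (jP k Dk).2 (below_mono _).
  by rewrite le_max (ltW (bP _ _)) ?orbT //; exists k.
have [fm|im] := pselect (finite_set (below m)); last first.
  by exists m => //; apply: card_bigcup_le.
apply: small_finite; apply: bigcup_finite; first exact: card_le_finite Di fm.
by move=> k Dk; apply: card_le_finite (Fm k Dk) fm.
Qed.

(** The ordinals of cofinality at least theta. The empty [D] excludes zero, and singletons exclude
    successors. *)
Definition cof_ge : set K := [set delta | forall D, D `<=` below delta -> small D ->
  exists2 b, b < delta & forall x, D x -> x < b].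

Lemma cof_ge_succ delta x : cof_ge delta -> x < delta -> exists2 y, y < delta & x < y.
Proof.
move=> Sd xd; have [|b bd bP] := Sd [set x] _ (small_set1 x).
  by move=> _ ->.
by exists b => //; apply: bP.
Qed.

Lemma cof_ge_bot delta : cof_ge delta -> bot < delta.
Proof.
move=> Sd; have [b bd _] := Sd set0 (@sub0set _ _) (small_finite (finite_set0 _)).
exact: le_lt_trans (hbot b) bd.
Qed.

Context (e : K -> K -> K).
Context (e_lt : forall b x, x < b -> e b x < theta).
Context (e_inj : forall b x y, x < b -> y < b -> e b x = e b y -> x = y).

(* The walk from [b] down to [a], in which the injection [e b] plays the role of
   a cofinal sequence in [b]: each step goes to the [e]-least ordinal of [[a, b)]. *)
Definition step_index a b := least theta [set i | exists2 g, a <= g < b & e b g = i].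
Definition next_step a b := least theta [set g | a <= g < b /\ e b g = step_index a b].
Definition step_sup a b := least theta [set u | forall g, g < b -> e b g < step_index a b -> g <= u].

Lemma next_stepP a b : a < b -> [/\ a <= next_step a b, next_step a b < b,
  e b (next_step a b) = step_index a b & forall g, a <= g -> g < b -> step_index a b <= e b g].
Proof.
move=> ab.
have : exists i, [set i | exists2 g, a <= g < b & e b g = i] i.
  by exists (e b a); exists a => //; rewrite lexx ab.
move=> /(leastP hK theta)[g0 g0P g0e].
have : exists g, [set g | a <= g < b /\ e b g = step_index a b] g by exists g0.
move=> /(leastP hK theta)[/andP[n1 n2] n3]; split => // g ag gb.
by apply: (least_le hK); exists g; rewrite ?ag.
Qed.

Lemma next_step_eq a b n : a <= n -> n < b ->
  (forall g, a <= g -> g < b -> e b n <= e b g) -> step_index a b = e b n /\ next_step a b = n.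
Proof.
move=> an nb nP; have [n1 n2 n3 n4] := next_stepP (le_lt_trans an nb).
have ixn : step_index a b = e b n by apply: le_anti; rewrite n4 //= -n3 nP.
by split=> //; apply: (e_inj n2 nb); rewrite n3.
Qed.

Lemma step_sup_ub a b g : g < b -> e b g < step_index a b -> g <= step_sup a b.
Proof.
move=> gb gi.
have : exists u, [set u | forall g, g < b -> e b g < step_index a b -> g <= u] u.
  by exists b => g' /ltW.
by move=> /(leastP hK theta); apply.
Qed.

Lemma step_sup_le a b u : (forall g, g < b -> e b g < step_index a b -> g <= u) -> step_sup a b <= u.
Proof. by move=> uP; apply: (least_le hK). Qed.

Lemma step_index_min a b g : a < b -> g < b -> e b g < step_index a b -> g < a.
Proof.
move=> ab gb; have [_ _ _ n4] := next_stepP ab.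
by apply: contraTT; rewrite -!leNgt => ag; apply: n4.
Qed.

Lemma step_sup_le_self a b : a < b -> step_sup a b <= a.
Proof. by move=> ab; apply: step_sup_le => g gb gi; apply: ltW; apply: step_index_min gi. Qed.

Lemma step_eq a delta b : a <= delta -> delta < b -> step_sup delta b < a ->
  [/\ step_index a b = step_index delta b, next_step a b = next_step delta b & step_sup a b = step_sup delta b].
Proof.
move=> ad db la; have [n1 n2 n3 n4] := next_stepP db.
have [i_eq n_eq] : step_index a b = step_index delta b /\ next_step a b = next_step delta b.
  rewrite -n3; apply: next_step_eq => // [|g ag gb]; first exact: le_trans n1.
  rewrite n3 leNgt; apply/negP => /(step_sup_ub gb) gl.
  by have := le_lt_trans gl la; rewrite ltNge ag.
by rewrite /step_sup i_eq n_eq.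
Qed.

(** The points with [e b]-value below [step_index delta b] lie below [delta] and are fewer than
    theta, so the cofinality of [delta] bounds them. *)
Lemma step_sup_lt delta b : cof_ge delta -> delta < b -> step_sup delta b < delta.
Proof.
move=> Sd db; have [_ n2 n3 _] := next_stepP db.
have [||c cd cP] := Sd [set g | g < b /\ e b g < step_index delta b].
- by move=> g [gb gi]; apply: step_index_min gi.
- exists (step_index delta b); first by rewrite -n3 e_lt.
  by apply: (@card_le_inj _ _ _ _ (e b)) => [g []//|x y [xb _] [yb _]]; apply: e_inj.
by apply: le_lt_trans cd; apply: step_sup_le => g gb gi; apply: ltW; apply: cP.
Qed.

Lemma small_e b i : i < theta -> small [set g | g < b /\ e b g <= i].
Proof.
move=> it; apply: small_le (small_upto it).
by apply: (@card_le_inj _ _ _ _ (e b)) => [g []//|x y [xb _] [yb _]]; apply: e_inj.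
Qed.

(** Fewer than theta points have an [e delta]-value at most that of [g]. For [nu] past all of them,
    the step towards [nu] has a larger index, so [g] is among the points bounded by
    [step_sup nu delta]. *)
Lemma step_sup_lim delta g : cof_ge delta -> g < delta ->
  exists2 b, b < delta & forall nu, b <= nu -> nu < delta -> g <= step_sup nu delta.
Proof.
move=> Sd gd; have [||b bd bP] := Sd [set x | x < delta /\ e delta x <= e delta g].
- by move=> x [].
- by apply: small_e; apply: e_lt.
exists b => // nu bnu nud; have [n1 n2 n3 _] := next_stepP nud.
apply: step_sup_ub => //; rewrite -n3 ltNge; apply/negP => eg.
by have := le_lt_trans (le_trans bnu n1) (bP _ (conj n2 eg)); rewrite ltxx.
Qed.

Context (walk : K -> K -> seq K).
Context (walkE : forall a b, walk a b = if a < b then b :: walk a (next_step a b) else [::]).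

Lemma walk_mem a b y : y \in walk a b -> a < y.
Proof.
elim/(wo_ind hK): b => b IH; rewrite walkE; case: ifP => // ab.
rewrite inE => /orP[/eqP->//|]; apply: IH; by have [] := next_stepP ab.
Qed.

(** By [step_eq], lowering the target from [delta] to [a] changes no step before [delta] is reached,
    as long as [a] stays above every [step_sup] met. *)
Lemma walk_cat a delta b : a <= delta -> delta <= b ->
  (forall y, y \in walk delta b -> step_sup delta y < a) ->
  [/\ walk a b = walk delta b ++ walk a delta,
      map (step_sup a) (walk delta b) = map (step_sup delta) (walk delta b) &
      map (step_index a) (walk delta b) = map (step_index delta) (walk delta b)].
Proof.
move=> ad; elim/(wo_ind hK): b => b IH.
rewrite le_eqVlt => /orP[/eqP<- _|db]; first by rewrite (walkE delta delta) ltxx.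
rewrite (walkE delta b) db => la.
have [|i_eq n_eq l_eq] := @step_eq a delta b ad db.
  by apply: la; rewrite inE eqxx.
have [n1 n2 _ _] := next_stepP db.
have [|t_eq l'_eq i'_eq] := IH _ n2 n1.
  by move=> y yt; apply: la; rewrite inE yt orbT.
by rewrite (walkE a b) (le_lt_trans ad db) n_eq t_eq /= l'_eq i'_eq l_eq i_eq.
Qed.

(** Todorcevic's maximal weight of a walk. *)
Definition rho x b := foldr Order.max bot (map (step_index x) (walk x b)).

Lemma rhoE x b : x < b -> rho x b = Order.max (step_index x b) (rho x (next_step x b)).
Proof. by move=> xb; rewrite /rho (walkE x b) xb. Qed.

Lemma foldr_max_cat (s1 s2 : seq K) : foldr Order.max bot (s1 ++ s2) =
  Order.max (foldr Order.max bot s1) (foldr Order.max bot s2).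
Proof.
elim: s1 => [|x s1 IH] /=; first by rewrite max_r.
by rewrite IH maxA.
Qed.

Lemma foldr_max_lt (s : seq K) u : bot < u -> (forall x, x \in s -> x < u) ->
  foldr Order.max bot s < u.
Proof.
move=> bu; elim: s => //= x s IH su; rewrite gt_max su ?inE ?eqxx //= IH // => y ys.
by rewrite su // inE ys orbT.
Qed.

Lemma foldr_max_ge (s : seq K) x : x \in s -> x <= foldr Order.max bot s.
Proof.
elim: s => //= y s IH; rewrite inE le_max => /orP[/eqP->|/IH->]; first by rewrite lexx.
by rewrite orbT.
Qed.

Lemma rho_step_index_lt x b : foldr Order.max bot (map (step_index x) (walk x b)) < theta.
Proof.
apply: foldr_max_lt; first exact: bot_lt_theta.
move=> _ /mapP[y /walk_mem xy ->]; have [_ n2 <- _] := next_stepP xy; exact: e_lt.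
Qed.

(** The first step of a walk of weight at most [i] has fewer than theta possible values, and the
    rest of the walk again has weight at most [i]. Induction on [b] and the regularity of theta
    conclude. *)
Lemma small_rho b i : i < theta -> small [set x | x < b /\ rho x b <= i].
Proof.
move=> it; elim/(wo_ind hK): b => b IH.
pose F g := [set x | x < g /\ rho x g <= i] `|` [set g].
apply: small_le (small_bigcup (F := F) (small_e b it) _).
  apply: subset_card_le => x [xb]; rewrite rhoE // ge_max => /andP[xi xr].
  have [n1 n2 n3 _] := next_stepP xb; exists (next_step x b); first by split; rewrite ?n3.
  by move: n1; rewrite le_eqVlt => /orP[/eqP|]; [right|left].
by move=> g [gb _]; apply: small_setU1; apply: IH.
Qed.

Lemma step_sup_bound delta b : cof_ge delta -> exists2 c, c < delta &
  forall y, y \in walk delta b -> step_sup delta y < c.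
Proof.
move=> Sd; have [|c cd cP] := cof_ge_succ Sd (x := foldr Order.max bot (map (step_sup delta) (walk delta b))).
  apply: foldr_max_lt; first exact: cof_ge_bot.
  by move=> _ /mapP[y /walk_mem dy ->]; apply: step_sup_lt.
exists c => // y yt; apply: le_lt_trans cP.
by apply: foldr_max_ge; apply: map_f.
Qed.

(* The traces from [b] and from [delta] agree below [delta], up to finitely many
   steps whose indices are eventually dominated. *)
Lemma rho_coherent delta b : cof_ge delta -> delta <= b -> exists2 c, c < delta &
  forall x, c <= x -> x < delta -> rho x b = rho x delta.
Proof.
move=> Sd db; have [c cd cP] := step_sup_bound b Sd.
have [||c' c'd c'P] := Sd [set x | x < delta /\ rho x delta <=
    foldr Order.max bot (map (step_index delta) (walk delta b))].
- by move=> x [].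
- by apply: small_rho; apply: rho_step_index_lt.
exists (Order.max c c'); first by rewrite gt_max cd c'd.
move=> x; rewrite ge_max => /andP[cx c'x] xd.
have [y /cP h|t_eq _ i_eq] := @walk_cat x delta b (ltW xd) db; first exact: lt_le_trans h cx.
rewrite {1}/rho t_eq map_cat foldr_max_cat i_eq max_r // leNgt; apply/negP => lt.
by have := c'P x (conj xd (ltW lt)); rewrite ltNge c'x.
Qed.

Lemma last_scanl (s : seq K) x :
  last x (scanl Order.max x s) = foldl Order.max x s.
Proof. by elim: s x => /=. Qed.

(* Todorcevic's lower trace, with repetitions. *)
Definition lower_trace a b := scanl Order.max bot (map (step_sup a) (walk a b)).

Lemma scanl_max_lt (s : seq K) x u : (forall y, y \in scanl Order.max x s -> y < u) ->
  forall y, y \in s -> y < u.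
Proof.
elim: s x => //= z s IH x su y; rewrite inE => /orP[/eqP->|ys].
  by have := su (Order.max x z); rewrite inE eqxx gt_max => /(_ isT)/andP[].
by apply: (IH (Order.max x z)) => // t ts; apply: su; rewrite inE ts orbT.
Qed.

Lemma scanl_max_ge (s : seq K) x y : y \in scanl Order.max x s -> x <= y.
Proof.
elim: s x => //= z s IH x; rewrite inE => /orP[/eqP->|/IH]; first by rewrite le_max lexx.
by rewrite ge_max => /andP[].
Qed.

Lemma scanl_max_le (s : seq K) x u y : x < u -> (forall z, z \in s -> z < u) ->
  y \in scanl Order.max x s -> y < u.
Proof.
elim: s x => //= z s IH x xu su.
have xzu : Order.max x z < u by rewrite gt_max xu su // inE eqxx.
rewrite inE => /orP[/eqP->//|]; apply: IH => // t ts.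
by apply: su; rewrite inE ts orbT.
Qed.

Lemma lower_trace_lt delta b y : cof_ge delta -> y \in lower_trace delta b -> y < delta.
Proof.
move=> Sd; apply: scanl_max_le; first exact: cof_ge_bot.
by move=> _ /mapP[z /walk_mem dz ->]; apply: step_sup_lt.
Qed.

Lemma lower_trace_le a b u y : a < u -> y \in lower_trace a b -> y < u.
Proof.
move=> au; apply: scanl_max_le; first exact: le_lt_trans au.
move=> _ /mapP[z /walk_mem dz ->]; exact: le_lt_trans (step_sup_le_self dz) au.
Qed.

Lemma lower_trace_ge a b y : a < b -> y \in lower_trace a b -> step_sup a b <= y.
Proof.
move=> ab; rewrite /lower_trace walkE ab /= max_r // inE => /orP[/eqP->//|].
exact: scanl_max_ge.
Qed.

Lemma lower_trace_neq0 a b : a < b -> lower_trace a b != [::].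
Proof. by move=> ab; rewrite /lower_trace walkE ab. Qed.

(** The bound by [a] lets the walks concatenate. The bound by [step_sup a delta] lets the running
    maximum restart from [bot] at [delta] without changing any term. *)
Lemma lower_trace_cat a delta b : a < delta -> delta <= b ->
  (forall y, y \in lower_trace delta b -> y < a) -> (forall y, y \in lower_trace delta b -> y <= step_sup a delta) ->
  lower_trace a b = lower_trace delta b ++ lower_trace a delta /\ walk a b = walk delta b ++ walk a delta.
Proof.
move=> ad db La Ll.
have la y : y \in walk delta b -> step_sup delta y < a.
  by move=> yt; apply: (scanl_max_lt La); apply: map_f.
have [t_eq l_eq _] := walk_cat (ltW ad) db la; split=> //.
rewrite /lower_trace t_eq map_cat scanl_cat l_eq; congr (_ ++ _).
rewrite (walkE a delta) ad /=.
suff : foldl Order.max bot (map (step_sup delta) (walk delta b)) <= step_sup a delta.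
  by move=> h; rewrite !max_r.
have -> : foldl Order.max bot (map (step_sup delta) (walk delta b)) = last bot (lower_trace delta b).
  by rewrite last_scanl.
have := mem_last bot (lower_trace delta b); rewrite inE => /orP[/eqP->//|]; exact: Ll.
Qed.
End Walks.

Arguments small {d K} theta {T} D.
Arguments cof_ge {d K} theta.

(** * Stationarity of the points of cofinality theta, and reflection *)

Section Stationary.
Context {d : Order.disp_t} {K : orderType d} {theta bot : K}.
Context (hK : wochoice.well_order (@Order.le d K)).
Context (htheta : infinite_cardinal theta) (hsucc : is_successor_cardinal_of theta).
Context (hreg : forall i, i < theta -> cof_gt i (below theta)).
Implicit Types (A D : set K) (G : K -> K).

(** A closure point reached in theta steps has cofinality at least theta, because fewer than theta
    indices are bounded in the regular theta. *)
Lemma cof_ge_stationary G (y : K) :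
  exists delta, [/\ cof_ge theta delta, y < delta & forall x, x < delta -> G x < delta].
Proof.
have [//||||||||z [p [_ yz Gz [pz pinc psup]]]] :=
  closure_point hK (R := [set: K]) (a := theta) (F := G) (y := y) => //.
- by move=> x _; have [x' xx'] := kappa_nomax hK htheta hsucc x; exists x'.
- by move=> b _; apply: kappa_regular_le hK htheta hsucc b.
- exact: kappa_regular hK htheta hsucc.
- exact: theta_limit htheta.
- by have [x xt] := infinite_setN0 htheta.2; exists x.
exists z; split=> // D Dz [i it Di].
have /exists_choice[j jP] : forall x, exists j, D x -> j < theta /\ x < p j.
  move=> x; have [/Dz/psup[j jt xj]|nDx] := pselect (D x); first by exists j.
  by exists theta.
have [||b bt bP] := hreg it (D := j @` D).
- by move=> _ [x /jP[jt _] <-].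
- exact: card_le_trans (card_image_le _ _) Di.
exists (p b); first exact: pz.
move=> x Dx; have [jt xj] := jP x Dx; apply: lt_trans xj _.
by apply: pinc => //; apply: bP; exists x.
Qed.

(* [delta] plays the role of the trace on [K] of an elementary submodel
   containing all the sets [X p]. *)
Lemma reflection {P : Type} (Par : K -> set P) (X : P -> set K) G (y : K) :
  (forall g, Par g #<= below theta) -> (forall g g', g <= g' -> Par g `<=` Par g') ->
  exists delta, [/\ cof_ge theta delta, y < delta, forall x, x < delta -> G x < delta &
    forall g p, g < delta -> Par g p -> (exists2 x, X p x & delta <= x) ->
      unbounded (X p) /\ forall g', g' < delta -> exists2 x, X p x & g' < x < delta].
Proof.
move=> Part Parmono.
(* [nx p g] is a point of [X p] above [g] if [X p] is unbounded, and an upper bound of [X p]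
   otherwise. Closing [delta] under it gives both conclusions. *)
have /exists_choice[nx nxP] : forall p, exists nx : K -> K,
    (unbounded (X p) -> forall g, X p (nx g) /\ g < nx g) /\
    (~ unbounded (X p) -> forall g x, X p x -> x <= nx g).
  move=> p; have [uX|nuX] := pselect (unbounded (X p)).
    have /exists_choice[f fP] : forall g, exists x, X p x /\ g < x.
      by move=> g; have [x Xx gx] := uX g; exists x.
    by exists f.
  have [c cP] : exists c, forall x, X p x -> x <= c.
    apply: contrapT => nc; apply: nuX => x; apply: contrapT => nx; apply: nc.
    by exists x => u Xu; rewrite leNgt; apply/negP => xu; apply: nx; exists u.
  by exists (fun=> c); split.
have /exists_choice[F FP] : forall g, exists c, G g <= c /\ forall p, Par g p -> nx p g < c.
  move=> g; have [c cP] := kappa_bound hK htheta hsucc (nx ^~ g) (Part g).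
  exists (Order.max (G g) c); split; first by rewrite le_max lexx.
  by move=> p /cP; rewrite lt_max orbC => ->.
have [delta [Sd yd Fd]] := cof_ge_stationary F y.
exists delta; split=> // [x /Fd|g p gd pg [x Xx dx]].
  by apply: le_lt_trans; have [] := FP x.
have uX : unbounded (X p).
  apply: contrapT => nuX; have [_ /(_ nuX g x Xx) xn] := nxP p.
  have [_ /(_ p pg) nF] := FP g.
  by have := lt_trans (le_lt_trans xn nF) (Fd g gd); rewrite ltNge dx.
split=> // g' g'd; pose h := Order.max g g'.
have hd : h < delta by rewrite gt_max gd g'd.
have [/(_ uX h)[Xn hn] _] := nxP p.
have [_ /(_ p (Parmono g h _ _ pg)) nF] := FP h.
exists (nx p h) => //; rewrite (le_lt_trans _ hn) ?le_max ?lexx ?orbT //=.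
by apply: lt_trans (nF _) (Fd h hd); rewrite le_max lexx.
Qed.

Lemma card_seq_le A : A #<= below theta ->
  [set s : seq K | forall x, x \in s -> A x] #<= below theta.
Proof.
move=> At; have natt := iffLR (infiniteP _) htheta.2.
pose F (n : nat) := [set s : seq K | size s = n /\ forall x, x \in s -> A x].
apply: card_le_trans (card_bigcup_le hK (F := F) htheta.2 natt _).
  by apply: subset_card_le => s sA; exists (size s).
elim=> [|n IH] _.
  apply: card_le_trans _ natt; apply: finite_set_countable.
  apply: sub_finite_set (finite_set1 [::]) => s [/size0nil-> _] //.
apply: card_le_trans _ (card_setX_le hK htheta.2 At (IH I)).
apply: (@card_le_inj _ _ _ _ (fun s => (head theta s, behead s))).
  move=> [|x s] [//= [ss] sA]; split=> //=; first by apply: sA; rewrite inE eqxx.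
  by split=> // y ys; apply: sA; rewrite inE ys orbT.
by move=> [|x s] [|y t] [//= _ _] [//= _ _] [-> ->].
Qed.

End Stationary.

(** The number of rises from [false] to [true], where [p] stands for the bit preceding [w]. *)
Fixpoint oscillation (p : bool) (w : seq bool) : nat :=
  if w is b :: w' then ((~~ p && b) + oscillation b w')%N else 0%N.

Lemma oscillation_cat p u v :
  oscillation p (u ++ v) = (oscillation p u + oscillation (last p u) v)%N.
Proof. by elim: u p => //= b u IH p; rewrite IH addnA. Qed.

Lemma oscillation_false p w : all negb w -> w != [::] ->
  oscillation p w = 0%N /\ last p w = false.
Proof.
case: w => // b w /= /andP[/negbTE-> wf] _; rewrite andbF.
by elim: w wf => //= c w IH /andP[/negbTE-> /IH[]].
Qed.

Lemma oscillation_true w : all id w -> w != [::] ->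
  oscillation false w = 1%N /\ last false w = true.
Proof.
case: w => // b w /= /andP[-> wt] _.
suff [-> ->] : oscillation true w = 0%N /\ last true w = true by [].
by elim: w wt => //= c w IH /andP[-> /IH[-> ->]].
Qed.

(** * Oscillations along the lower trace *)

Section Oscillation.
Context {d : Order.disp_t} {K : orderType d} {theta bot : K}.
Context (hK : wochoice.well_order (@Order.le d K)).
Context (htheta : infinite_cardinal theta) (hsucc : is_successor_cardinal_of theta).
Context (hbot : forall x, bot <= x).
Context (hreg : forall i, i < theta -> cof_gt i (below theta)).
Context (e : K -> K -> K).
Context (e_lt : forall b x, x < b -> e b x < theta).
Context (e_inj : forall b x y, x < b -> y < b -> e b x = e b y -> x = y).
Context (walk : K -> K -> seq K).
Context (walkE : forall a b, walk a b = if a < b then b :: walk a (next_step (theta := theta) e a b) else [::]).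
Implicit Types (a b x y z n g al be : K) (A B : set K) (F w : seq K).

Local Notation rho := (@rho _ K theta bot e walk).
Local Notation lower_trace := (@lower_trace _ K theta bot e walk).
Local Notation step_sup := (@step_sup _ K theta e).

(** Otherwise unboundedly many [g] have a counterexample with one common [n]. Let [delta] be closed
    under these, and [al] in [A] lie above [delta]. The points below [delta] of weight at most [n]
    to [al] are bounded, but a counterexample placed between that bound and [delta] contains such a
    point. *)
Lemma rho_unbounded A : unbounded A -> exists g0, forall g, g0 <= g ->
  forall n z w, n < theta -> (forall x, x \in w -> g <= x) ->
  exists al, [/\ A al, z < al & forall x, x \in w -> n < rho x al].
Proof.
move=> uA; apply: contrapT => nex.
have /exists_choice[q qP] : forall g, exists q : K * K * seq K, [/\ q.1.1 < theta,
    forall x, x \in q.2 -> g <= x &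
    forall al, A al -> q.1.2 < al -> exists2 x, x \in q.2 & rho x al <= q.1.1].
  move=> g; apply: contrapT => nq; apply: nex; exists g => g' gg' n z w nt wg.
  apply: contrapT => nal; apply: nq; exists (n, z, w); split=> //= [x /wg|al Aal zal].
    exact: le_trans.
  apply: contrapT => nx; apply: nal; exists al; split=> // x xw.
  by rewrite ltNge; apply/negP => xn; apply: nx; exists x.
have [//||n nt un] := unbounded_pigeonhole hK htheta hsucc (A := [set: K])
    (D := below theta) (F := fun n => [set g | (q g).1.1 = n]) _ (card_lexx _) _.
- by move=> x; have [y xy] := kappa_nomax hK htheta hsucc x; exists y.
- by move=> g _; exists (q g).1.1 => //; case: (qP g).
have /exists_choice[nx nxP] : forall g, exists g', (q g').1.1 = n /\ g < g'.
  by move=> g; have [g' [_ gn] gg'] := un g; exists g'.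
pose G g := Order.max (nx g) (Order.max (q (nx g)).1.2 (foldr Order.max bot (q (nx g)).2)).
have [delta [Sd _ Gd]] := cof_ge_stationary hK htheta hsucc hreg G bot.
have [al Aal dal] := uA delta.
have [||b bd bP] := Sd [set x | x < delta /\ rho x al <= n].
- by move=> x [].
- apply: small_le (small_rho hK htheta hbot hreg e_inj walkE al nt).
  by apply: subset_card_le => x [xd xr]; split=> //; apply: lt_trans dal.
have [nb bnx] := nxP b; have [_ wP zP] := qP (nx b).
have := Gd b bd; rewrite !gt_max => /and3P[nxd zd wd].
have [x xw xr] := zP al Aal (lt_trans zd dal).
have xd : x < delta by apply: le_lt_trans wd; apply: foldr_max_ge.
have := bP x; rewrite -nb => /(_ (conj xd xr)).
by rewrite ltNge (le_trans (ltW bnx) (wP x xw)).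
Qed.

Section Extension.
Context (A B : set K) (delta : K).

(* [delta'] reflects [delta]: [al] and [be] agree beyond [g] below [delta'] and
   have prescribed values on the prescribed trace [F] of [be]. *)
Definition reflects (p : K * (seq K * (seq K * seq K))) delta' :=
  cof_ge theta delta' /\ exists al be, [/\ A al, B be, delta' < al, delta' < be &
    [/\ lower_trace delta' be = p.2.1, map (rho ^~ al) p.2.1 = p.2.2.1,
      map (rho ^~ be) p.2.1 = p.2.2.2 &
      forall x, p.1 <= x -> x < delta' -> rho x al = rho x be]].

(** The three families to which elementarity is applied: points from which no reflection of [delta]
    has a [step_sup] reaching [p.1], members of [A] with prescribed weights, and the thresholds of
    [rho_unbounded] for those members. A common parameter [p] lets one use of [reflection] cover all
    three. *)
Definition definable (i : nat) (p : K * (seq K * (seq K * seq K))) : set K :=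
  match i with
  | 0%N => [set nu | forall delta', nu < delta' -> reflects p delta' -> step_sup nu delta' < p.1]
  | 1%N => [set al | A al /\ map (rho ^~ al) p.2.1 = p.2.2.1]
  | _ => [set g0 | forall g, g0 <= g ->
      forall n z w, n < theta -> (forall x, x \in w -> g <= x) ->
      exists al, [/\ A al /\ map (rho ^~ al) p.2.1 = p.2.2.1,
        z < al & forall x, x \in w -> n < rho x al]]
  end.

Context (Sd : cof_ge theta delta) (td : theta < delta).
Context (good : forall p i, p.1 < delta -> (forall x, x \in p.2.1 -> x < delta) ->
  (forall x, x \in p.2.2.1 -> x < theta) -> (forall x, x \in p.2.2.2 -> x < theta) ->
  (exists2 x, definable i p x & delta <= x) -> unbounded (definable i p) /\
  forall g, g < delta -> exists2 x, definable i p x & g < x < delta).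

Lemma rho_lt x al : rho x al < theta.
Proof. exact: (rho_step_index_lt hK htheta hbot e_lt walkE). Qed.

Lemma map_rho_lt al F x : x \in map (rho ^~ al) F -> x < theta.
Proof. by case/mapP => y _ ->; apply: rho_lt. Qed.

Lemma seq_bound F : (forall x, x \in F -> x < delta) ->
  exists2 g, g < delta & forall x, x \in F -> x < g.
Proof.
move=> Fd.
have [|g gd gP] := cof_ge_succ htheta hbot Sd (x := foldr Order.max bot F).
  by apply: foldr_max_lt => //; apply: (cof_ge_bot htheta hbot Sd).
by exists g => // x xF; apply: le_lt_trans gP; apply: foldr_max_ge.
Qed.

(** A second point [delta'] above [delta] with the same trace and weights lengthens the trace: the
    walk from [be'] passes through [delta'], and the new part [w] lies where the weights to [al']
    and [be'] agree. *)
Lemma extend_equal al be g0 : A al -> B be -> delta < al -> delta < be -> g0 < delta ->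
  exists al' be' w, [/\ A al', B be', delta < al', delta < be' &
    [/\ lower_trace delta be' = lower_trace delta be ++ w, w != [::],
      forall x, x \in w -> g0 <= x /\ rho x al' = rho x be',
      forall x, x \in lower_trace delta be -> rho x al' = rho x al &
      forall x, x \in lower_trace delta be -> rho x be' = rho x be]].
Proof.
move=> Aal Bbe dal dbe g0d.
have [c1 c1d c1P] := rho_coherent hK htheta hbot hreg e_lt e_inj walkE Sd (ltW dal).
have [c2 c2d c2P] := rho_coherent hK htheta hbot hreg e_lt e_inj walkE Sd (ltW dbe).
have [c3 c3d c3P] := seq_bound (F := lower_trace delta be) (fun x => lower_trace_lt hK htheta hbot e_lt e_inj walkE Sd).
pose g := Order.max (Order.max g0 c1) (Order.max c2 c3).
have gd : g < delta by rewrite !gt_max g0d c1d c2d c3d.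
have [[g0g c1g] [c2g c3g]] : (g0 <= g /\ c1 <= g) /\ (c2 <= g /\ c3 <= g).
  by rewrite /g !le_max !lexx ?orbT.
pose p := (g, (lower_trace delta be, (map (rho ^~ al) (lower_trace delta be), map (rho ^~ be) (lower_trace delta be)))).
have pd : reflects p delta.
  split=> //; exists al, be; split=> //; split=> //= x gx xd.
  by rewrite c1P ?c2P //; [exact: le_trans gx|exact: le_trans gx].
have pF x : x \in p.2.1 -> x < delta by apply: lower_trace_lt.
have pa x : x \in p.2.2.1 -> x < theta by apply: map_rho_lt.
have pb x : x \in p.2.2.2 -> x < theta by apply: map_rho_lt.
(* Otherwise reflection would give arbitrarily large [nu] below [delta] with [step_sup nu delta]
   below [g], against [step_sup_lim]. The failure at [delta] then supplies [delta']. *)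
have : ~ definable 0 p delta.
  move=> nd; have [|_ refl] := good (p := p) (i := 0%N) gd pF pa pb; first by exists delta.
  have [c cd cP] := step_sup_lim hK htheta e_lt e_inj Sd gd.
  have [nu /(_ delta) nuP /andP[cnu nud]] := refl c cd.
  by have := nuP nud pd; rewrite ltNge cP // ltW.
move=> /existsNP[delta' /not_implyP[dd' /not_implyP[[Sd' [al' [be' [Aal' Bbe' d'al' d'be' [LF Lal Lbe co]]]]] /negP]]].
rewrite -leNgt /= => glam.
have [||L_eq _] := lower_trace_cat hK hbot e_inj walkE dd' (ltW d'be').
- by move=> y; rewrite LF; apply: pF.
- by move=> y; rewrite LF => /c3P /ltW yc; apply: le_trans glam; apply: le_trans yc c3g.
exists al', be', (lower_trace delta delta'); rewrite L_eq LF; split=> //.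
- exact: lt_trans d'al'.
- exact: lt_trans d'be'.
split=> //; first exact: lower_trace_neq0.
- move=> x xw; have gx : g <= x by apply: le_trans glam (lower_trace_ge hbot walkE dd' xw).
  split; first exact: le_trans gx.
  by apply: co => //; apply: lt_trans dd'; apply: lower_trace_lt xw.
- by move: Lal => /= /eq_in_map h x /h.
- by move: Lbe => /= /eq_in_map h x /h.
Qed.

Definition bits al be w := [seq rho x be < rho x al | x <- w].

(** The extension has two blocks: on [w1] the weights agree, giving bits [false]; on [w2] a new
    [al3] outweighs [be2], giving bits [true]. Whatever bit precedes, there is exactly one rise. *)
Lemma extend_oscillation al be : A al -> B be -> delta < al -> delta < be ->
  exists al' be' w, [/\ A al', B be', delta < al', delta < be' &
    [/\ lower_trace delta be' = lower_trace delta be ++ w,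
      forall q, oscillation q (bits al' be' w) = 1%N /\ last q (bits al' be' w) = true,
      forall x, x \in lower_trace delta be -> rho x al' = rho x al &
      forall x, x \in lower_trace delta be -> rho x be' = rho x be]].
Proof.
move=> Aal Bbe dal dbe; have bd := cof_ge_bot htheta hbot Sd.
have [al1 [be1 [w1 [Aal1 Bbe1 dal1 dbe1 [L1 w1n w1P al1E be1E]]]]] :=
  extend_equal Aal Bbe dal dbe bd.
pose p : K * (seq K * (seq K * seq K)) := (bot, (lower_trace delta be1, (map (rho ^~ al1) (lower_trace delta be1), [::]))).
have pF x : x \in p.2.1 -> x < delta by apply: lower_trace_lt.
have pa x : x \in p.2.2.1 -> x < theta by apply: map_rho_lt.
have pb x : x \in p.2.2.2 -> x < theta by [].
have [|uA1 _] := good (p := p) (i := 1%N) bd pF pa pb; first by exists al1; [|exact: ltW].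
have [g2 g2P] := rho_unbounded uA1.
(* Elementarity brings a threshold below [delta], so that the second block can be placed above
   it. *)
have [|_ /(_ bot bd)[g3 g3P /andP[_ g3d]]] := good (p := p) (i := 2) bd pF pa pb.
  exists (Order.max g2 delta); last by rewrite le_max lexx orbT.
  move=> g; rewrite ge_max => /andP[g2g _] n z w nt wg.
  exact: g2P g2g n z w nt wg.
have [al2 [be2 [w2 [_ Bbe2 _ dbe2 [L2 w2n w2P _ be2E]]]]] := extend_equal Aal1 Bbe1 dal1 dbe1 g3d.
have [||al3 [[Aal3 al3E] dal3 al3P]] := g3P g3 (lexx _) (foldr Order.max bot (map (rho ^~ be2) w2)) delta w2.
- apply: foldr_max_lt; first exact: bot_lt_theta.
  by move=> x; apply: map_rho_lt.
- by move=> x /w2P[].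
have {}al3E x : x \in lower_trace delta be1 -> rho x al3 = rho x al1.
  by move: al3E => /= /eq_in_map; apply.
exists al3, be2, (w1 ++ w2); split=> //; split.
- by rewrite L2 L1 catA.
- move=> q; rewrite /bits map_cat oscillation_cat last_cat.
  have [||-> ->] := @oscillation_false q [seq rho x be2 < rho x al3 | x <- w1].
  + rewrite all_map; apply/allP => x xw /=.
    have xL : x \in lower_trace delta be1 by rewrite L1 mem_cat xw orbT.
    by rewrite al3E // be2E //; have [_ ->] := w1P x xw; rewrite ltxx.
  + by case: (w1) w1n.
  apply: oscillation_true; last by case: (w2) w2n.
  rewrite all_map; apply/allP => x xw /=; apply: le_lt_trans (al3P x xw).
  by apply: foldr_max_ge => //; apply: map_f.
- by move=> x xL; rewrite al3E ?al1E // L1 mem_cat xL.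
- by move=> x xL; rewrite be2E ?be1E // L1 mem_cat xL.
Qed.

(** Each round adds one rise to the longest trace. The new [al'] keeps the weights of [al] on the
    old trace, so the counts for the earlier [bes m] survive. *)
Lemma iterate_oscillation N : unbounded A -> unbounded B ->
  exists al (bes : nat -> K) o, [/\ A al, delta < al & forall m, (m <= N)%N ->
    [/\ B (bes m), delta < bes m, {subset lower_trace delta (bes m) <= lower_trace delta (bes N)},
      oscillation true (bits al (bes m) (lower_trace delta (bes m))) = (o + m)%N &
      last true (bits al (bes m) (lower_trace delta (bes m))) = true]].
Proof.
move=> uA uB; elim: N => [|N [al [bes [o [Aal dal besP]]]]].
  have [al Aal dal] := uA delta; have [be Bbe dbe] := uB delta.
  have [al' [be' [w [Aal' Bbe' dal' dbe' [L_eq wP _ _]]]]] := extend_oscillation Aal Bbe dal dbe.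
  exists al', (fun=> be'), (oscillation true (bits al' be' (lower_trace delta be'))); split=> // m.
  rewrite leqn0 => /eqP->; split=> //; first by rewrite addn0.
  by rewrite L_eq /bits map_cat last_cat; case: (wP (last true [seq rho x be' < rho x al' | x <- lower_trace delta be])).
have [BN dN _ oN lN] := besP N (leqnn N).
have [al' [be' [w [Aal' Bbe' dal' dbe' [L_eq wP alE beE]]]]] := extend_oscillation Aal BN dal dN.
exists al', (fun m => if (m <= N)%N then bes m else be'), o; split=> // m; rewrite ltnn.
case: (leqP m N) => [mN _|Nm mN1].
  have [Bm dm sm om lm] := besP m mN; have bE : bits al' (bes m) (lower_trace delta (bes m)) =
      bits al (bes m) (lower_trace delta (bes m)).
    by apply/eq_in_map => x /sm xL; rewrite alE.
  by split=> //; rewrite ?bE // => x /sm xL; rewrite L_eq mem_cat xL.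
have -> : m = N.+1 by apply/eqP; rewrite eqn_leq mN1 Nm.
have bE : bits al' be' (lower_trace delta (bes N)) = bits al (bes N) (lower_trace delta (bes N)).
  by apply/eq_in_map => x xL; rewrite alE // beE.
have [w1 w2] := wP true.
rewrite L_eq /bits map_cat -!/(bits _ _ _) bE oscillation_cat last_cat oN lN w1 w2.
by split=> //; rewrite addn1 addnS.
Qed.
End Extension.

Definition osc al be := oscillation true (bits al be (lower_trace al be)).

(** Reflecting [al] to [al'] below [delta] appends to each trace the part from [delta] down to
    [al']. There the weights to every [bes m] coincide with those to [delta], and each word before
    it ends in [true], so the same number is added to every count. *)
Lemma osc_consecutive A B (G : K -> K) N : unbounded A -> unbounded B ->
  exists al delta (bes : nat -> K) o, [/\ A al, al < delta, forall x, x < delta -> G x < delta &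
    forall m, (m <= N)%N -> [/\ B (bes m), delta < bes m & osc al (bes m) = (o + m)%N]].
Proof.
move=> uA uB.
pose Par g : set (nat * (K * (seq K * (seq K * seq K)))) := [set: nat] `*` (below g `*`
  ([set s | forall x, x \in s -> below g x] `*` ([set s | forall x, x \in s -> below theta x] `*`
  [set s | forall x, x \in s -> below theta x]))).
have inft : infinite_set (below theta) := htheta.2.
have [||delta [Sd td Gd good]] := reflection hK htheta hsucc hreg (Par := Par)
    (fun q => definable A B q.1 q.2) G theta.
- move=> g; have sg := below_le hK hsucc g; rewrite /Par.
  have st := card_seq_le hK htheta (card_lexx (below theta)).
  apply: (card_setX_le hK inft (iffLR (infiniteP _) inft)).
  apply: (card_setX_le hK inft sg).
  by apply: (card_setX_le hK inft (card_seq_le hK htheta sg)); apply: (card_setX_le hK inft st).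
- move=> g g' gg' [i [g0 [F [a b]]]] [_ [/= g0g [Fg ab]]]; split=> //; split=> /=.
    exact: lt_le_trans gg'.
  by split=> // x /Fg xg; apply: lt_le_trans gg'.
have {}good p i : p.1 < delta -> (forall x, x \in p.2.1 -> x < delta) ->
  (forall x, x \in p.2.2.1 -> x < theta) -> (forall x, x \in p.2.2.2 -> x < theta) ->
  (exists2 x, definable A B i p x & delta <= x) -> unbounded (definable A B i p) /\
  forall g, g < delta -> exists2 x, definable A B i p x & g < x < delta.
  move=> pd Fd a_t b_t ex.
  have [|g gd gP] := seq_bound Sd (F := p.1 :: p.2.1).
    by move=> x; rewrite inE => /orP[/eqP->//|/Fd].
  apply: (good g (i, p)) => //; split=> //; split; first by apply: gP; rewrite inE eqxx.
  by split=> // x xF; apply: gP; rewrite inE xF orbT.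
have [al [bes [o [Aal dal besP]]]] := iterate_oscillation Sd good N uA uB.
have /exists_choice[c cP] : forall m, exists c, (m <= N)%N -> c < delta /\
    forall x, c <= x -> x < delta -> rho x (bes m) = rho x delta.
  move=> m; have [mN|_] := leqP m N; last by exists theta.
  have [_ dm _ _ _] := besP m mN.
  have [c cd cP] := rho_coherent hK htheta hbot hreg e_lt e_inj walkE Sd (ltW dm).
  by exists c.
have [|g gd gP] := seq_bound Sd (F := lower_trace delta (bes N) ++ [seq c m | m <- iota 0 N.+1]).
  move=> x; rewrite mem_cat => /orP[/(lower_trace_lt hK htheta hbot e_lt e_inj walkE Sd)//|/mapP[m]].
  by rewrite mem_iota add0n ltnS => /andP[_ mN] ->; case: (cP m mN).
have [g' g'd g'P] := step_sup_lim hK htheta e_lt e_inj Sd gd.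
have bd := cof_ge_bot htheta hbot Sd.
pose p : K * (seq K * (seq K * seq K)) :=
  (bot, (lower_trace delta (bes N), (map (rho ^~ al) (lower_trace delta (bes N)), [::]))).
have pF x : x \in p.2.1 -> x < delta by apply: lower_trace_lt.
have pa x : x \in p.2.2.1 -> x < theta by apply: map_rho_lt.
have pb x : x \in p.2.2.2 -> x < theta by [].
have [|_ refl] := good p 1%N bd pF pa pb; first by exists al; [|exact: ltW].
have gg'd : Order.max g g' < delta by rewrite gt_max gd g'd.
have [al' [Aal' al'E]] := refl _ gg'd.
rewrite gt_max => /andP[/andP[gal' g'al'] al'd].
have gl : g <= step_sup al' delta by apply: g'P => //; apply: ltW.
have {}al'E x : x \in lower_trace delta (bes N) -> rho x al' = rho x al.
  by move: al'E => /= /eq_in_map; apply.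
exists al', delta, bes, (o + oscillation true (bits al' delta (lower_trace al' delta)))%N; split=> // m mN.
have [Bm dm sm om lm] := besP m mN; split=> //.
have Lg y : y \in lower_trace delta (bes m) -> y < g.
  by move=> /sm ys; apply: gP; rewrite mem_cat ys.
have [||L_eq _] := lower_trace_cat hK hbot e_inj walkE al'd (ltW dm).
- by move=> y /Lg /lt_trans; apply.
- by move=> y /Lg /ltW /le_trans; apply.
rewrite /osc L_eq /bits map_cat -!/(bits _ _ _) oscillation_cat.
have -> : bits al' (bes m) (lower_trace delta (bes m)) = bits al (bes m) (lower_trace delta (bes m)).
  by apply/eq_in_map => x /sm xs; rewrite al'E.
have -> : bits al' (bes m) (lower_trace al' delta) = bits al' delta (lower_trace al' delta).
  apply/eq_in_map => x xL; congr (_ < _); have [cd cm] := cP m mN; apply: cm.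
    apply: le_trans (le_trans gl (lower_trace_ge hbot walkE al'd xL)).
    apply: ltW; apply: gP; rewrite mem_cat map_f ?orbT // mem_iota add0n ltnS.
    by [].
  exact: (lower_trace_le hK hbot walkE al'd xL).
by rewrite om lm addnAC.
Qed.
End Oscillation.

Lemma logn2_interval o n : exists2 m, (m <= 2 ^ n.+1)%N & logn 2 (o + m) = n.
Proof.
have p0 : (0 < 2 ^ n)%N by rewrite expn_gt0.
have [k [k1 k2]] : exists k, (o <= 2 ^ n * k.*2.+1 /\ 2 ^ n * k.*2.+1 <= o + 2 ^ n.+1)%N.
  rewrite expnS; set p := (2 ^ n)%N in p0 *.
  (* This [k] makes [p * k.*2.+1] the least odd multiple of [p] that is at least [o]. *)
  exists ((o + p - 1) %/ (2 * p))%N.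
  have := divn_eq (o + p - 1) (2 * p); have := ltn_pmod (o + p - 1) (d := (2 * p)%N).
  set k := (_ %/ _)%N; set r := (_ %% _)%N; rewrite muln_gt0 p0 => /(_ isT) rl e.
  rewrite -mul2n mulnS mulnCA; nia.
exists (2 ^ n * k.*2.+1 - o)%N; first by rewrite leq_subLR.
by rewrite subnKC // lognM // pfactorK // lognE /= dvdn2 /= odd_double /= addn0.
Qed.

(** * Ulam matrices and the colouring for regular theta *)

Section RegularTheta.
Context {d : Order.disp_t} {K : orderType d} {theta bot : K}.
Context (hK : wochoice.well_order (@Order.le d K)).
Context (htheta : infinite_cardinal theta) (hsucc : is_successor_cardinal_of theta).
Context (hbot : forall x, bot <= x).
Context (hreg : forall i, i < theta -> cof_gt i (below theta)).
Context (e : K -> K -> K).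
Context (e_lt : forall b x, x < b -> e b x < theta).
Context (e_inj : forall b x y, x < b -> y < b -> e b x = e b y -> x = y).

Definition stationary (X : set K) := forall (G : K -> K) y,
  exists delta, [/\ X delta, y < delta & forall x, x < delta -> G x < delta].

(** Row [x] of an Ulam matrix splits the [delta] above [x] into theta pieces. If each missed a club,
    a common closure point of the theta functions involved would have no value left for
    [e delta x]. *)
Lemma ulam_row x : exists2 i, i < theta &
  stationary [set delta | [/\ cof_ge theta delta, x < delta & e delta x = i]].
Proof.
apply: contrapT => no.
have /exists_choice[Gy GyP] : forall i, exists Gy : (K -> K) * K, i < theta ->
    forall delta, cof_ge theta delta -> x < delta -> e delta x = i -> Gy.2 < delta ->
    ~ (forall z, z < delta -> Gy.1 z < delta).
  move=> i; apply: contrapT => nGy; apply: no; exists i.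
    by apply: contrapT => nit; apply: nGy; exists (id, x).
  move=> G y; apply: contrapT => nd; apply: nGy; exists (G, y) => it delta Sd xd ei yd Gd.
  by apply: nd; exists delta; split.
have /exists_choice[G GP] : forall z, exists c, forall i, i < theta -> (Gy i).1 z < c.
  by move=> z; apply: (kappa_bound hK htheta hsucc (fun i => (Gy i).1 z) (card_lexx (below theta))).
have [c cP] := kappa_bound hK htheta hsucc (fun i => (Gy i).2) (card_lexx (below theta)).
have [delta [Sd]] := cof_ge_stationary hK htheta hsucc hreg G (Order.max c x).
rewrite gt_max => /andP[cd xd] Gd; have it := e_lt xd.
apply: (GyP _ it delta Sd xd erefl); first exact: lt_trans (cP _ it) cd.
by move=> z zd; apply: lt_trans (GP z _ it) (Gd z zd).
Qed.

(** Unboundedly many rows have a stationary entry in one common column [i0], and injectivity of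
    [e delta] makes the entries of a column disjoint. [h delta] names the row containing [delta];
    the default [bot] is still a colour. *)
Lemma ulam_partition : exists h : K -> K, (forall x, h x < theta) /\
  forall tau, tau < theta -> stationary [set delta | cof_ge theta delta /\ h delta = tau].
Proof.
have /exists_choice[i iP] : forall x, exists i, i < theta /\
    stationary [set delta | [/\ cof_ge theta delta, x < delta & e delta x = i]].
  by move=> x; have [i it st] := ulam_row x; exists i.
have [||i0 i0t uX] := unbounded_pigeonhole hK htheta hsucc (A := [set: K])
    (D := below theta) (F := fun j => [set x | i x = j]) _ (card_lexx _) _.
- by move=> x; have [y xy] := kappa_nomax hK htheta hsucc x; exists y.
- by move=> x _; exists (i x) => //; case: (iP x).
have [X [XP Xi]] := unbounded_inj hK htheta hsucc uX.
pose P delta := [set tau | [/\ tau < theta, X tau < delta & e delta (X tau) = i0]].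
exists (fun delta => xget bot (P delta)); split=> [x|tau tt G y].
  by case: xgetP => [t _ []|_] //; apply: bot_lt_theta.
have [_ Xtau] := XP tau tt; have [_ /(_ G y)[delta]] := iP (X tau).
rewrite Xtau => -[[Sd xd ed] yd Gd]; exists delta; split=> //; split=> //.
apply: xget_unique => // t [t_theta Xtd et]; apply: Xi => //.
by apply: (e_inj (b := delta)) => //; rewrite et ed.
Qed.

Context (walk : K -> K -> seq K).
Context (walkE : forall a b, walk a b = if a < b then b :: walk a (next_step (theta := theta) e a b) else [::]).

(** Pressing down: were all fibres bounded, some [delta] in [X] would be closed under the suprema
    over [n] of the bounds for [(g, n)], and would exceed the bound of its own fibre. *)
Lemma fodor (X : set K) (f : K -> K * nat) : stationary X ->
  (forall delta, X delta -> (f delta).1 < delta) ->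
  exists p, unbounded (X `&` [set delta | f delta = p]).
Proof.
move=> sX fX; apply: contrapT => no.
have /exists_choice[b bP] : forall p, exists b, forall delta, X delta -> f delta = p -> delta <= b.
  move=> p; apply: contrapT => nb; apply: no; exists p => x; apply: contrapT => nx.
  apply: nb; exists x => delta Xd fd; rewrite leNgt; apply/negP => xd.
  by apply: nx; exists delta.
have /exists_choice[G GP] : forall g, exists c, forall n : nat, [set: nat] n -> b (g, n) < c.
  move=> g; apply: (kappa_bound hK htheta hsucc (fun n => b (g, n))).
  exact: iffLR (infiniteP _) htheta.2.
have [delta [Xd _ Gd]] := sX G bot.
have := Gd _ (fX delta Xd); rewrite ltNge => /negP; apply.
apply: le_trans (bP (f delta) delta Xd erefl) (ltW _).
by case: (f delta) => g n /=; apply: GP.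
Qed.

Definition walk_colour (h : K -> K) a b :=
  h (nth bot (walk a b) (logn 2 (osc (theta := theta) (bot := bot) e walk a b))).

Lemma walk_colour_onto h : (forall tau, tau < theta ->
    stationary [set delta | cof_ge theta delta /\ h delta = tau]) ->
  forall A tau, unbounded A -> tau < theta -> exists c, forall b, c <= b ->
    exists eta, [/\ A eta, eta < c & walk_colour h eta b = tau].
Proof.
move=> hS A tau uA tt; apply: contrapT => no.
(* If the claim fails, each [c] has a point [beta c] from [c] on that no [eta] of [A] below [c]
   joins in colour [tau]. *)
have /exists_choice[beta betaP] : forall c, exists b, c <= b /\
    forall eta, A eta -> eta < c -> walk_colour h eta b <> tau.
  move=> c; apply: contrapT => nb; apply: no; exists c => b cb.
  apply: contrapT => neta; apply: nb; exists b; split=> // eta Aeta etac hc.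
  by apply: neta; exists eta.
(* Walks from [beta delta] to any [eta] in a final segment of [delta] meet [delta] at one position,
   the length of the walk from [beta delta] to [delta]. *)
have /exists_choice[f fP] : forall delta, exists p : K * nat, cof_ge theta delta -> p.1 < delta /\
    forall eta, p.1 <= eta -> eta < delta -> nth bot (walk eta (beta delta)) p.2 = delta.
  move=> delta; have [Sd|nSd] := pselect (cof_ge theta delta); last by exists (bot, 0%N).
  have [c cd cP] := step_sup_bound hK htheta hbot e_lt e_inj walkE (beta delta) Sd.
  exists (c, size (walk delta (beta delta))) => _; split=> // eta ceta etad.
  have [y /cP h1|-> _ _] := walk_cat hK e_inj walkE (ltW etad) (betaP delta).1.
    exact: lt_le_trans h1 ceta.
  by rewrite nth_cat ltnn subnn (walkE eta delta) etad.
have [|[g n] uX] := fodor (f := f) (hS tau tt); first by move=> delta [/fP[]].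
set X := _ `&` _ in uX.
have uA' : unbounded (A `&` [set x | g <= x]).
  move=> x; have [y Ay] := uA (Order.max x g); rewrite gt_max => /andP[xy gy].
  by exists y => //; split=> //; apply: ltW.
have uB : unbounded (beta @` X).
  move=> x; have [y Xy xy] := uX x; exists (beta y); first by exists y.
  exact: lt_le_trans xy (betaP y).1.
have [al [delta [bes [o [[Aal gal] ald Gd besP]]]]] :=
  osc_consecutive hK htheta hsucc hbot hreg e_lt e_inj walkE beta (2 ^ n.+1)%N uA' uB.
have [m mN mo] := logn2_interval o n.
have [[delta' [[Sd' hd'] fd'] <-] dd' om] := besP m mN.
(* Since [delta] is closed under [beta] and [beta delta'] lies above it, [delta'] is not below
   [delta]. *)
have add' : al < delta'.
  apply: lt_le_trans ald _; rewrite leNgt; apply/negP => /Gd lt.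
  by have := lt_trans lt dd'; rewrite ltxx.
apply: ((betaP delta').2 al Aal add').
have [_ /(_ al)] := fP delta' Sd'; rewrite fd' /= => /(_ gal add') nth_eq.
by rewrite /walk_colour om mo nth_eq.
Qed.
End RegularTheta.

Lemma injections_into {d : Order.disp_t} {K : orderType d} {theta : K} :
  wochoice.well_order (@Order.le d K) -> is_successor_cardinal_of theta ->
  exists e : K -> K -> K, (forall b x, x < b -> e b x < theta) /\
    (forall b x y, x < b -> y < b -> e b x = e b y -> x = y).
Proof.
move=> hK hsucc.
have /exists_choice[e eP] : forall b, exists f : K -> K, (forall x, x < b -> f x < theta) /\
    (forall x y, x < b -> y < b -> f x = f y -> x = y).
  by move=> b; apply: card_le_ex theta (below_le hK hsucc b).
by exists e; split=> b; have [] := eP b.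
Qed.

Lemma onto_pp_regular (d : Order.disp_t) (K : orderType d) (theta : K) :
  wochoice.well_order (@Order.le d K) -> is_successor_cardinal_of theta ->
  regular_cardinal theta -> onto_pp (full_size_sets K) (complete_ideals K) theta.
Proof.
move=> hK hsucc [htheta [_ cof]].
have [bot _ hbot] := ex_least hK (P := [set: K]) (ex_intro _ theta I).
have {}hbot x : bot <= x by apply: hbot.
have hreg i : i < theta -> cof_gt i (below theta).
  move=> it D Dt Di; apply: contrapT => nb.
  suff : theta <= i by rewrite leNgt it.
  apply: cof; have [f [fi finj]] := card_le_ex theta Di.
  pose g j := xget bot [set x | D x /\ f x = j].
  have gf x : D x -> g (f x) = x.
    by move=> Dx; apply: xget_unique => // y [Dy]; apply: finj.
  exists g; split=> [j _|a ta].
    rewrite /g; case: xgetP => [x _ [/Dt]|_] //; exact: (bot_lt_theta htheta hbot).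
  apply: contrapT => nj; apply: nb; exists a => // x Dx.
  rewrite ltNge; apply/negP => ax; apply: nj; exists (f x); first exact: fi.
  by rewrite gf.
have [e [e_lt e_inj]] := injections_into hK hsucc.
have /exists_choice[walk walkE] : forall a, exists walk : K -> seq K, forall b,
    walk b = if a < b then b :: walk (next_step (theta := theta) e a b) else [::].
  move=> a; apply: (lt_recursion hK [::]) => b g h gh.
  by case: ifP => // ab; rewrite gh //; case: (next_stepP (theta := theta) hK e ab).
have [h [ht hS]] := ulam_partition hK htheta hsucc hbot hreg e_lt e_inj.
apply: (onto_pp_intro hK htheta hsucc (c := walk_colour (theta := theta) (bot := bot) e walk h)).
  by move=> a b _; apply: ht.
exact: (walk_colour_onto hK htheta hsucc hbot hreg e_lt e_inj walkE hS).
Qed.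

(** * Club guessing *)

Section ClubGuessing.
Context {d : Order.disp_t} {K : orderType d}.
Context (hK : wochoice.well_order (@Order.le d K)).
Context (nu0 nu nu1 chi : K).
Context (nu_cof : cof_gt nu0 (below nu)) (nu_lim : forall j, j < nu -> exists2 j', j' < nu & j < j').
Context (nu1_cof : cof_gt nu (below nu1)) (nu1_lim : forall j, j < nu1 -> exists2 j', j' < nu1 & j < j').
Context (chi_cof : forall b, b < chi -> cof_gt b (below chi))
  (chi_lim : forall j, j < chi -> exists2 j', j' < chi & j < j').
Context (nu_gt0 : exists j, j < nu) (nu_lt : nu < nu1) (nu1_lt : nu1 < chi).
Implicit Types (F : K -> K) (s : set K) (x y z i j : K).

Definition closure_points F : set K := [set j | j < chi /\ forall x, x < j -> F x < j].

Definition preserves F := forall x, x < chi -> F x < chi.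

Definition ladder i s := [/\ s `<=` below i, forall y, y < i -> exists2 x, s x & y < x &
  s #<= below nu].

Definition limit_of i F := i < chi /\
  forall y, y < i -> exists2 z, closure_points F z & y < z < i.

(** A closure point of [nx], reached in [nu] steps, is a limit of closure points of [F]; the steps
    form its ladder. *)
Lemma limit_of_exists F : preserves F ->
  exists i, [/\ limit_of i F, cof_gt nu0 (below i) & exists s, ladder i s].
Proof.
move=> Fp.
have initR : initial (below chi) by move=> x y xc yx; apply: le_lt_trans yx xc.
have cp F' y : preserves F' -> y < chi -> exists z (p : K -> K), [/\ z < chi, y < z,
    forall x, x < z -> F' x < z & [/\ forall j, j < nu -> p j < z,
    forall i j, i < j -> j < nu -> p i < p j & forall x, x < z -> exists2 j, j < nu & x < p j]].
  move=> F'p yc; apply: (closure_point hK (R := below chi) (a := nu)) => //.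
  exact: chi_cof (lt_trans nu_lt nu1_lt).
have /exists_choice[nx nxP] : forall y, exists z, y < chi -> closure_points F z /\ y < z.
  move=> y; have [yc|nyc] := pselect (y < chi); last by exists y.
  by have [z [p [zc yz zF _]]] := cp F y Fp yc; exists z.
have [j0 j0nu] := nu_gt0.
have [|i [p [ic _ iF [pi pinc psup]]]] := cp nx j0 _ (lt_trans j0nu (lt_trans nu_lt nu1_lt)).
  by move=> x /nxP[[]].
exists i; split.
- split=> // y yi; have [cz yz] := nxP y (lt_trans yi ic).
  by exists (nx y) => //; rewrite yz iF.
- move=> D Di Dnu0.
  have /exists_choice[j jP] : forall x, exists j, D x -> j < nu /\ x < p j.
    move=> x; have [/Di/psup[j jn xj]|nDx] := pselect (D x); first by exists j.
    by exists j0.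
  have [||b bt bP] := nu_cof (D := j @` D).
  + by move=> _ [x /jP[jt _] <-].
  + exact: card_le_trans (card_image_le _ _) Dnu0.
  exists (p b); first exact: pi.
  move=> x Dx; have [jt xj] := jP x Dx; apply: lt_trans xj _.
  by apply: pinc => //; apply: bP; exists x.
- exists (p @` below nu); split.
  + by move=> _ [j /pi pj <-].
  + by move=> y /psup[j jn yj]; exists (p j) => //; exists j.
  + exact: card_image_le.
Qed.

Definition last_point F x := least x [set u | forall z, closure_points F z -> z <= x -> z <= u].

(** The supremum of closure points up to [x] is itself closed: any [w] below it lies below some
    closure point [z], and then so does [F w]. *)
Lemma last_pointP F x : x < chi -> [/\ closure_points F (last_point F x),
  last_point F x <= x & forall z, closure_points F z -> z <= x -> z <= last_point F x].
Proof.
move=> xc; pose Q := [set u | forall z, closure_points F z -> z <= x -> z <= u].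
have ub : Q (last_point F x) by apply: (leastP hK x (P := Q)); exists x.
have le : last_point F x <= x by apply: (least_le hK).
split=> //; split=> [|w wl]; first exact: le_lt_trans le xc.
apply: contrapT => nF.
suff : last_point F x <= w by rewrite leNgt wl.
apply: (least_le hK) => z zF zx; rewrite leNgt; apply/negP => wz.
by apply: nF; apply: lt_le_trans (zF.2 w wz) (ub z zF zx).
Qed.

(* Were every [F] refuted by some [F'], iterating [nu1] times would give
   decreasing sets of closure points; below a limit [i] of all of them each last
   point stabilizes, and the [nu] stages involved are bounded in [nu1]. *)
Lemma club_guess_aux (s : K -> set K) : (forall i, (exists s0, ladder i s0) -> ladder i (s i)) ->
  exists F, preserves F /\ forall F', preserves F' -> exists i,
    [/\ limit_of i F, cof_gt nu0 (below i), ladder i (s i) &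
      forall x, s i x -> closure_points F' (last_point F x)].
Proof.
move=> sP; apply: contrapT => no.
have /exists_choice[R RP] : forall F, exists F', preserves F' /\ (preserves F ->
    forall i, limit_of i F -> cof_gt nu0 (below i) -> ladder i (s i) ->
    ~ forall x, s i x -> closure_points F' (last_point F x)).
  move=> F; apply: contrapT => nF'; apply: no.
  have [pF|npF] := pselect (preserves F); last by case: nF'; exists id; split=> // /npF.
  exists F; split=> // F' pF'; apply: contrapT => ni; apply: nF'.
  by exists F'; split=> // _ i li ci lai sx; apply: ni; exists i.
pose Phi F x := Order.max (F x) (R F x).
have PhiP F : preserves F -> preserves (Phi F).
  by move=> pF x xc; rewrite gt_max pF // (RP F).1.
pose G z (h : K -> K -> K) x := least x [set b | forall z', z' < z -> Phi (h z') x < b].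
have [z g h gh|Fs FsE] := lt_recursion hK id (G := G).
  apply/funext => x; apply: eq_least => b; split=> bP z' z'z; have := bP z' z'z.
    by rewrite gh.
  by rewrite gh.
have FsP z : z < chi -> preserves (Fs z) /\
    forall z' x, z' < z -> x < chi -> Phi (Fs z') x < Fs z x.
  elim/(wo_ind hK): z => z IH zc.
  have bd x : x < chi -> exists2 b, b < chi & forall z', z' < z -> Phi (Fs z') x < b.
    move=> xc; have [||b bc bP] := chi_cof zc (D := (fun z' => Phi (Fs z') x) @` below z).
    - move=> _ [z' z'z <-]; have [pFz' _] := IH z' z'z (lt_trans z'z zc).
      exact: PhiP pFz' _ xc.
    - exact: card_image_le.
    by exists b => // z' z'z; apply: bP; exists z'.
  split=> [x /bd[b bc bP]|z' x z'z /bd[b bc bP]]; rewrite [Fs z]FsE /G.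
    by apply: le_lt_trans bc; apply: (least_le hK).
  suff : [set b | forall z', z' < z -> Phi (Fs z') x < b] (least x [set b | forall z', z' < z -> Phi (Fs z') x < b]).
    by apply.
  by apply: (leastP hK); exists b.
have clP z' z j : z' < z -> z < chi -> closure_points (Fs z) j ->
    closure_points (Fs z') j /\ closure_points (R (Fs z')) j.
  move=> z'z zc [jc jF]; have [_ Fz] := FsP z zc.
  by split; split=> // x xj; have := lt_trans (Fz z' x z'z (lt_trans xj jc)) (jF x xj);
    rewrite gt_max => /andP[].
have [pF _] := FsP nu1 nu1_lt.
have [i [[ic il] icof /sP ladi]] := limit_of_exists pF.
have lt_chi z : z < nu1 -> z < chi by move=> zn; apply: lt_trans zn nu1_lt.
have lim z : z < nu1 -> limit_of i (Fs z).
  move=> zn; split=> // y /il[j jF yji]; exists j => //.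
  by have [] := clP z nu1 j zn nu1_lt jF.
have [si _ scard] := ladi.
have anti x z' z : x < chi -> z' <= z -> z < chi -> last_point (Fs z) x <= last_point (Fs z') x.
  move=> xc; rewrite le_eqVlt => /orP[/eqP->//|z'z] zc.
  have [cl le _] := last_pointP (Fs z) xc; have [_ _ max'] := last_pointP (Fs z') xc.
  by apply: max' => //; have [] := clP z' z _ z'z zc cl.
have [j0 j0nu] := nu_gt0.
have /exists_choice[m mP] : forall x, exists m, x < chi -> m < nu1 /\
    forall z, z < nu1 -> last_point (Fs m) x <= last_point (Fs z) x.
  move=> x; have [y [m mn my] ymin] := ex_least hK
    (P := [set y | exists2 z, z < nu1 & last_point (Fs z) x = y])
    (ex_intro _ _ (ex_intro2 _ _ j0 (lt_trans j0nu nu_lt) erefl)).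
  by exists m => _; split=> // z zn; rewrite my; apply: ymin; exists z.
have xchi x : s i x -> x < chi by move=> /si xi; apply: lt_trans xi ic.
have [||z zn zP] := nu1_cof (D := m @` s i).
- by move=> _ [x /xchi/mP[mn _] <-].
- exact: card_le_trans (card_image_le _ _) scard.
have [z2 z2n zz2] := nu1_lim zn.
have [pFz _] := FsP z (lt_chi z zn).
apply: ((RP (Fs z)).2 pFz i (lim z zn) icof ladi) => x sx.
have xc := xchi x sx; have [mn mmin] := mP x xc.
have mz : m x <= z by apply: ltW; apply: zP; exists x.
have -> : last_point (Fs z) x = last_point (Fs z2) x.
  apply: le_anti; apply/andP; split; last exact: anti xc (ltW zz2) (lt_chi z2 z2n).
  by apply: le_trans (anti x (m x) z xc mz (lt_chi z zn)) (mmin z2 z2n).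
have [cl _ _] := last_pointP (Fs z2) xc.
by have [] := clP z z2 _ zz2 (lt_chi z2 z2n) cl.
Qed.

(** The guessing set [cc i] is the ladder of [i] projected to the closure points of the function
    given by [club_guess_aux]. It is cofinal in [i], hence has no last point, and exceeds [nu0] in
    size because the cofinality of [i] does. *)
Lemma club_guess : exists cc : K -> set K, forall F, preserves F -> exists i,
  [/\ i < chi, cc i `<=` closure_points F, forall j, cc i j -> exists2 j', cc i j' & j < j' &
    ~ (cc i #<= below nu0)].
Proof.
have /exists_choice[s sP] : forall i, exists s, (exists s0, ladder i s0) -> ladder i s.
  by move=> i; have [[s ls]|nl] := pselect (exists s0, ladder i s0); [exists s|exists set0].
have [F [_ FP]] := club_guess_aux sP.
exists (fun i => last_point F @` s i) => F' /FP[i [[ic il] icof [si sun _] scl]].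
have above y : y < i -> exists2 j, (last_point F @` s i) j & y < j.
  move=> yi; have [z zF /andP[yz zi]] := il y yi; have [x sx zx] := sun z zi.
  exists (last_point F x); first by exists x.
  have [_ _ max'] := last_pointP F (lt_trans (si x sx) ic).
  exact: lt_le_trans yz (max' z zF (ltW zx)).
have lt_i j : (last_point F @` s i) j -> j < i.
  case=> x sx <-; have [_ le _] := last_pointP F (lt_trans (si x sx) ic).
  exact: le_lt_trans le (si x sx).
exists i; split=> //.
- by move=> _ [x sx <-]; apply: scl.
- by move=> j /lt_i/above.
- move=> card; have [b bi bP] := icof _ lt_i card.
  by have [j cj bj] := above b bi; have := lt_trans bj (bP j cj); rewrite ltxx.
Qed.
End ClubGuessing.

(** * Successors of singular cardinals *)

Section SingularTheta.
Context {d : Order.disp_t} {K : orderType d} {theta bot : K}.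
Context (hK : wochoice.well_order (@Order.le d K)).
Context (htheta : infinite_cardinal theta) (hsucc : is_successor_cardinal_of theta).
Context (hbot : forall x, bot <= x).
Context {l : K} {g : K -> K} (l_lt : l < theta) (hg : cofinal_map l theta g).
Implicit Types (a b x y z i j al be : K).

Lemma singular_index_infinite : infinite_set (below l).
Proof.
move=> fl; have [gl gcof] := hg.
have [s sE] := (iffLR (finite_seqP _)) (finite_image g fl).
have [|b bt bP] := theta_limit htheta (i := foldr Order.max bot s).
  apply: foldr_max_lt; first exact: bot_lt_theta htheta hbot.
  move=> x xs; have : [set` s] x by []; rewrite -sE => -[j jl <-]; exact: gl.
have [j jl bj] := gcof b bt.
have gs : g j \in s by have : [set` s] (g j) by rewrite -sE; exists j.
by have := le_lt_trans (le_trans bj (foldr_max_ge gs)) bP; rewrite ltxx.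
Qed.

Definition succ_card a := least theta [set b | ~ (below b #<= below a)].

Lemma succ_cardP a : a < theta -> ~ (below (succ_card a) #<= below a) /\
  forall x, x < succ_card a -> below x #<= below a.
Proof.
move=> ta; split.
  apply: (leastP hK theta (P := [set b | ~ (below b #<= below a)])).
  by exists theta; apply: cardinal_nle.
move=> x xs; apply: contrapT => nx.
by have := least_le hK theta (P := [set b | ~ (below b #<= below a)]) nx; rewrite leNgt xs.
Qed.

Lemma lt_succ_card a : a < theta -> a < succ_card a.
Proof.
by move=> /succ_cardP[ns _]; rewrite ltNge; apply/negP => /below_mono.
Qed.

Lemma succ_card_regular a : a < theta -> infinite_set (below a) -> cof_gt a (below (succ_card a)).
Proof.
move=> ta ia; have [ns sP] := succ_cardP ta.
by apply: (cof_gt_succ hK ia) => // x y xc yx; apply: le_lt_trans yx xc.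
Qed.

(** If [theta] were at most [succ_card a], its cofinality would exceed [a] as for successor
    cardinals, against the cofinal map [g] from [l <= a]. *)
Lemma succ_card_lt a : a < theta -> l <= a -> succ_card a < theta.
Proof.
move=> ta la; rewrite ltNge; apply/negP => ts.
have ia := infinite_below la singular_index_infinite.
have [gl gcof] := hg.
have th_cof : cof_gt a (below theta).
  apply: (cof_gt_succ hK ia) => [x y xc yx|x xt|]; first exact: le_lt_trans yx xc.
    by apply: (succ_cardP ta).2; apply: lt_le_trans ts.
  exact: cardinal_nle.
have [||b bt bP] := th_cof (g @` below l).
- by move=> _ [j jl <-]; apply: gl.
- exact: card_le_trans (card_image_le _ _) (below_mono la).
have [j jl bj] := gcof b bt.
by have := le_lt_trans bj (bP (g j) (ex_intro2 _ _ j jl erefl)); rewrite ltxx.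
Qed.

Lemma succ_card_limit a j : a < theta -> infinite_set (below a) ->
  j < succ_card a -> exists2 j', j' < succ_card a & j < j'.
Proof.
move=> ta ia js; have [|//|j' js' jP] := succ_card_regular ta ia (D := [set j]).
- by move=> _ ->.
- apply: card_le_trans _ (iffLR (infiniteP _) ia).
  exact: finite_set_countable (finite_set1 _).
by exists j' => //; apply: jP.
Qed.

Lemma card_setU_le {T : Type} (A B : set T) a : infinite_set (below a) ->
  A #<= below a -> B #<= below a -> A `|` B #<= below a.
Proof.
move=> ia Aa Ba.
have -> : A `|` B = \bigcup_(c in [set: bool]) (if c then A else B).
  apply/seteqP; split=> [x [Ax|Bx]|x [[] _ //]]; [by exists true|by exists false|by left|by right].
apply: card_bigcup_le => //; last by case.
apply: card_le_trans _ (iffLR (infiniteP _) ia).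
exact: countableP.
Qed.

Context (e : K -> K -> K).
Context (e_lt : forall b x, x < b -> e b x < theta).
Context (e_inj : forall b x y, x < b -> y < b -> e b x = e b y -> x = y).

Definition club delta (C : set K) a := [/\ C `<=` below delta,
  forall y, y < delta -> exists2 z, C z & y < z,
  forall x, x < delta -> (forall y, y < x -> exists2 z, C z & y < z < x) -> C x,
  C #<= below a & a < theta].

Definition dominated (C : K -> set K) (cb : K -> K) be i : set K :=
  [set al | al < be /\ (e be al <= g i \/ [/\ club be (C be) (cb be), C be al & cb be <= g i])].

(* [f be] is built to exceed [f al] at [i] for every [al < be] once [g i] is large
   enough depending on [al], and for all [al] in a club of [be] at once. *)
Lemma dominating_sequence : exists (f : K -> K -> K) (C : K -> set K) (cb : K -> K),
  [/\ forall be, (exists C' a, club be C' a) -> club be (C be) (cb be),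
     forall be i, i < l -> f be i < theta &
     forall be i al, i < l -> dominated C cb be i al -> f al i < f be i].
Proof.
have /exists_choice[Cc CcP] : forall be, exists p : set K * K,
    (exists C' a, club be C' a) -> club be p.1 p.2.
  move=> be; have [[C' [a Ca]]|nC] := pselect (exists C' a, club be C' a).
    by exists (C', a).
  by exists (set0, theta).
pose C be := (Cc be).1; pose cb be := (Cc be).2.
pose G be (f : K -> K -> K) i :=
  least theta [set x | forall al, dominated C cb be i al -> f al i < x].
have [be f h fh|f fE] := lt_recursion hK id (G := G).
  apply/funext => i; apply: eq_least => x; split=> xP al Da; have := xP al Da.
    by rewrite fh //; case: Da.
  by rewrite fh //; case: Da.
(* Raising [g i] to at least [l] makes it infinite. At most [gw i] ordinals must be dominated at
   index [i], so the values stay below the regular cardinal [succ_card (gw i)]. *)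
pose gw i := Order.max (g i) l.
have gw_lt i : i < l -> gw i < theta by move=> il; rewrite gt_max l_lt (hg.1 i il).
have gw_inf i : infinite_set (below (gw i)).
  by apply: infinite_below singular_index_infinite; rewrite le_max lexx orbT.
have sgw i : i < l -> succ_card (gw i) < theta.
  by move=> il; apply: succ_card_lt (gw_lt i il) _; rewrite le_max lexx orbT.
have dom_card be i : dominated C cb be i #<= below (gw i).
  have ggw : g i <= gw i by rewrite le_max lexx.
  apply: card_le_trans (card_setU_le (gw_inf i) (A := [set al | al < be /\ e be al <= g i])
    (B := [set al | club be (C be) (cb be) /\ C be al /\ cb be <= g i]) _ _).
  - apply: subset_card_le => al [ab [eg|[? ? ?]]]; [by left|by right].
  - apply: card_le_trans _ (card_upto_le (gw_inf i) (below_mono ggw)).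
    by apply: (@card_le_inj _ _ _ _ (e be)) => [x []//|x y [xb _] [yb _]]; apply: e_inj.
  - have [[cl cg]|no] := pselect (club be (C be) (cb be) /\ cb be <= g i); last first.
      suff -> : [set al | club be (C be) (cb be) /\ C be al /\ cb be <= g i] = set0.
        exact: card_ge0.
      by apply/seteqP; split=> // x [? [? ?]]; apply: no.
    have [_ _ _ Ccard _] := cl.
    apply: card_le_trans (card_le_trans Ccard (below_mono (le_trans cg ggw))).
    by apply: subset_card_le => x [_ []].
have f_ub be i : i < l -> (forall al, al < be -> f al i < succ_card (gw i)) ->
    exists2 b, b < succ_card (gw i) & forall al, dominated C cb be i al -> f al i < b.
  move=> il IH; have [||b bs bP] := succ_card_regular (gw_lt i il) (gw_inf i)
    (D := (f ^~ i) @` dominated C cb be i).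
  - by move=> _ [al [ab _] <-]; apply: IH.
  - exact: card_le_trans (card_image_le _ _) (dom_card be i).
  by exists b => // al Da; apply: bP; exists al.
have f_lt be i : i < l -> f be i < succ_card (gw i).
  move=> il; elim/(wo_ind hK): be => be IH.
  have [b bs bP] := f_ub be i il IH; rewrite [f be]fE.
  by apply: le_lt_trans bs; apply: (least_le hK).
exists f, C, cb; split=> [//|be i il|be i al il Da].
  by apply: lt_trans (f_lt be i il) (sgw i il).
have [b bs bP] := f_ub be i il (fun al _ => f_lt al i il).
rewrite [f be]fE.
apply: (leastP hK theta (P := [set x | forall al, dominated C cb be i al -> f al i < x])) Da.
by exists b.
Qed.

Context (f : K -> K -> K) (C : K -> set K) (cb : K -> K).
Context (C_club : forall be, (exists C' a, club be C' a) -> club be (C be) (cb be))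
  (f_lt : forall be i, i < l -> f be i < theta)
  (f_dom : forall be i al, i < l -> dominated C cb be i al -> f al i < f be i).

(* Domination beyond [a]: the filter on the index set [below l] is generated by
   the sets [[set i | a <= g i]] with [a < theta]. *)
Definition lt_from a al be := forall i, i < l -> a <= g i -> f al i < f be i.

Lemma lt_from_le a a' al be : a <= a' -> lt_from a al be -> lt_from a' al be.
Proof. by move=> aa' h i il ag; apply: h => //; apply: le_trans ag. Qed.

Lemma lt_from_trans a al be ga : lt_from a al be -> lt_from a be ga -> lt_from a al ga.
Proof. by move=> h1 h2 i il ag; apply: lt_trans (h1 i il ag) (h2 i il ag). Qed.

Lemma lt_from_lt al be : al < be -> exists2 a, a < theta & lt_from a al be.
Proof.
move=> ab; exists (e be al); first exact: e_lt.
by move=> i il eg; apply: f_dom => //; split=> //; left.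
Qed.

Lemma lt_from_club al be : club be (C be) (cb be) -> C be al -> lt_from (cb be) al be.
Proof.
move=> cl Ca i il cg; apply: f_dom => //; have [Cb _ _ _ _] := cl.
by split; [exact: Cb|right].
Qed.

Definition uniformly_below (W : set K) be :=
  exists2 a, a < theta & forall x, W x -> lt_from a x be.

Lemma uniformly_below_lt W be ga : be < ga -> uniformly_below W be -> uniformly_below W ga.
Proof.
move=> /lt_from_lt[a' a't bg] [a aT Wb]; exists (Order.max a a'); first by rewrite gt_max aT.
move=> x /Wb xb; apply: (@lt_from_trans _ _ be).
  by apply: lt_from_le xb; rewrite le_max lexx.
by apply: lt_from_le bg; rewrite le_max lexx orbT.
Qed.

Section Chain.
Context (chi : K) (cc : K -> set K) (U : set K).
Context (chi_lt : chi < theta) (chi_lim : forall j, j < chi -> exists2 j', j' < chi & j < j').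
Context (uU : unbounded U).

(** [xi] is built continuous, with [sig j] in [U] between [xi j] and all later terms. As only [chi]
    many sets [cc i] matter, one [sig j] can lie above a uniform bound for each of their images up
    to [j] that has one. *)
Lemma chain : exists xi sig : K -> K, [/\ forall j, U (sig j) /\ xi j < sig j,
    forall j' j, j' < j -> sig j' < xi j,
    forall x j, x < xi j -> exists j', j' < j /\ forall j2, j' < j2 -> x < xi j2 &
    forall j i be, i < chi -> uniformly_below (xi @` (cc i `&` upto j)) be ->
      uniformly_below (xi @` (cc i `&` upto j)) (sig j)].
Proof.
have /exists_choice[sg sgP] : forall p : (K -> set K) * K, exists s, [/\ U s, p.2 < s &
    forall i be, i < chi -> uniformly_below (p.1 i) be -> uniformly_below (p.1 i) s].
  move=> [W x] /=.
  have /exists_choice[b bP] : forall i, exists b, forall be, uniformly_below (W i) be ->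
      uniformly_below (W i) b.
    move=> i; have [[b ub]|nb] := pselect (exists b, uniformly_below (W i) b).
      by exists b.
    by exists x => be ub; case: nb; exists be.
  have [c cP] := kappa_bound hK htheta hsucc b (below_mono (ltW chi_lt)).
  have [s Us] := uU (Order.max c x); rewrite gt_max => /andP[cs xs].
  exists s; split=> // i be ic /bP; apply: uniformly_below_lt.
  exact: lt_trans (cP i ic) cs.
have /exists_choice[up upP] : forall s : K, exists s' : K, s < s'.
  by move=> s; apply: (kappa_nomax hK htheta hsucc).
pose P (xi : K -> K) j := (fun i => xi @` (cc i `&` upto j), xi j).
pose G j xi := least theta [set x | forall j', j' < j -> up (sg (P xi j')) <= x].
have [j xi xi' eq_xi|xi xiE] := lt_recursion hK theta (G := G).
  apply: eq_least => x; suff eqP j' : j' < j -> P xi j' = P xi' j'.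
    by split=> xP j' jj'; move: (xP j' jj'); rewrite eqP.
  move=> j'j; rewrite /P eq_xi //; congr (_, _); apply/funext => i.
  by apply: eq_imagel => y [_ yj']; apply: eq_xi; apply: le_lt_trans j'j.
have xi_ub j' j : j' < j -> up (sg (P xi j')) <= xi j.
  move=> j'j; rewrite [xi j]xiE.
  apply: (leastP hK theta (P := [set x | forall i, i < j -> up (sg (P xi i)) <= x])) j'j.
  have [c cP] := kappa_bound hK htheta hsucc (fun i => up (sg (P xi i))) (below_le hK hsucc j).
  by exists c => i /cP/ltW.
exists xi, (fun j => sg (P xi j)); split.
- by move=> j; have [] := sgP (P xi j).
- by move=> j' j /xi_ub; apply: lt_le_trans (upP _).
- move=> x j xj; suff [j' j'j xs] : exists2 j', j' < j & x < up (sg (P xi j')).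
    by exists j'; split=> // j2 /xi_ub; apply: lt_le_trans.
  apply: contrapT => no; suff : xi j <= x by rewrite leNgt xj.
  rewrite [xi j]xiE; apply: (least_le hK) => j' j'j; rewrite leNgt; apply/negP => xs.
  by apply: no; exists j'.
- by move=> j i be ic; have [_ _ /(_ i be ic)] := sgP (P xi j).
Qed.

Context (nu0 : K) (l_le : l <= nu0).
Context (guess : forall F, preserves chi F -> exists i,
  [/\ i < chi, cc i `<=` closure_points chi F, forall j, cc i j -> exists2 j', cc i j' & j < j' &
    ~ (cc i #<= below nu0)]).

(** With [delta] the supremum of the chain, the guessed [cc i] is mapped by [xi] into the club
    attached to [delta]. So [f delta] dominates these points uniformly, and by the choice of [sig]
    each [sig j] does the same up to [j]. With a common bound [g k0] for more than [nu0] many [j],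
    the pattern [sig j], [xi (nx j)], [sig j'] makes [f] increasing along [sig]. *)
Lemma strongly_increasing_subset : infinite_set (below nu0) ->
  exists M a, [/\ M `<=` U, ~ (M #<= below nu0), M #<= below chi, a < theta &
    forall i, i < l -> a <= g i -> forall al be, M al -> M be -> f al i = f be i -> al = be].
Proof.
move=> inu0; have [xi [sig [sigP sig_lt xi_sup sig_dom]]] := chain.
have xi_lt j' j : j' < j -> xi j' < xi j.
  by move=> j'j; apply: lt_trans (sigP j').2 (sig_lt _ _ j'j).
have xi_inv j' j : xi j' < xi j -> j' < j.
  by move=> xx; rewrite ltNge; apply/negP; rewrite le_eqVlt => /orP[/eqP e1|/xi_lt];
    [move: xx; rewrite e1 ltxx|move=> /(lt_trans xx); rewrite ltxx].
pose delta := least theta [set x | forall j, j < chi -> xi j <= x].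
have xi_le j : j < chi -> xi j <= delta.
  apply: (leastP hK theta (P := [set x | forall j, j < chi -> xi j <= x])).
  have [c cP] := kappa_bound hK htheta hsucc xi (below_mono (ltW chi_lt)).
  by exists c => i /cP/ltW.
have delta_sup y : y < delta -> exists2 j, j < chi & y < xi j.
  move=> yd; apply: contrapT => no; suff : delta <= y by rewrite leNgt yd.
  by apply: (least_le hK) => j jc; rewrite leNgt; apply/negP => yx; apply: no; exists j.
have xi_delta j : j < chi -> xi j < delta.
  move=> jc; have [j' j'c jj'] := chi_lim jc.
  exact: lt_le_trans (xi_lt _ _ jj') (xi_le j' j'c).
have clD : club delta (C delta) (cb delta).
  apply: C_club; exists (xi @` below chi), chi; split=> //.
  - by move=> _ [j /xi_delta xd <-].
  - by move=> y /delta_sup[j jc yx]; exists (xi j) => //; exists j.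
  - move=> x /delta_sup[j1 j1c xj1] xlim.
    have [j xj jmin] := ex_least hK (P := fun j => x <= xi j) (ex_intro _ j1 (ltW xj1)).
    have jc : j < chi by apply: le_lt_trans (jmin j1 (ltW xj1)) j1c.
    exists j => //; apply: le_anti; rewrite xj andbT leNgt; apply/negP => /xi_sup[j' [j'j j'P]].
    have xj' : xi j' < x by rewrite ltNge; apply/negP => /jmin; rewrite leNgt j'j.
    have [_ [m mc <-] /andP[/xi_inv j'm mx]] := xlim _ xj'.
    by have := lt_trans (j'P m j'm) mx; rewrite ltxx.
  - exact: card_image_le.
have [Csub Cun Ccl _ cbt] := clD.
(* A point of the club lies between [xi j] and [xi (F j)], so at closure points [j] of [F]
   continuity puts [xi j] in the club. *)
have /exists_choice[F FP] : forall j, exists j', j < chi -> j' < chi /\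
    exists2 c, C delta c & xi j < c < xi j'.
  move=> j; have [jc|njc] := pselect (j < chi); last by exists j.
  have [c Cc jc'] := Cun _ (xi_delta j jc); have [j' j'c cj'] := delta_sup c (Csub c Cc).
  by exists j' => _; split=> //; exists c => //; rewrite jc' cj'.
have [i [ic icl inext icard]] := guess (F := F) (fun x xc => (FP x xc).1).
have xiC j : cc i j -> C delta (xi j).
  move=> cj; have [jc jF] := icl j cj; apply: Ccl; first exact: xi_delta.
  move=> y /xi_sup[j' [j'j j'P]].
  have Fj' := jF j' j'j; have [_ [c0 _ /andP[h1 h2]]] := FP j' (lt_trans j'j jc).
  have [_ [c Cc /andP[h3 h4]]] := FP (F j') (lt_trans Fj' jc).
  exists c => //; apply/andP; split.
    by apply: lt_trans (j'P _ _) h3; apply: xi_inv; apply: lt_trans h1 h2.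
  by apply: lt_trans h4 (xi_lt _ _ (jF _ Fj')).
have domj j : uniformly_below (xi @` (cc i `&` upto j)) (sig j).
  apply: (sig_dom _ _ delta ic); exists (cb delta) => // _ [m [cm _] <-].
  by apply: lt_from_club => //; apply: xiC.
have /exists_choice[nx nxP] : forall j, exists n, cc i j ->
    [/\ cc i n, j < n & forall m, cc i m -> j < m -> n <= m].
  move=> j; have [cj|ncj] := pselect (cc i j); last by exists j.
  have [j' cj' jj'] := inext j cj.
  have [n [cn jn] nmin] := ex_least hK (P := fun n => cc i n /\ j < n)
    (ex_intro _ j' (conj cj' jj')).
  by exists n => _; split=> // m cm jm; apply: nmin.
have /exists_choice[k kP] : forall j, exists k, cc i j -> [/\ k < l,
    forall m, cc i m -> m <= j -> lt_from (g k) (xi m) (sig j) &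
    lt_from (g k) (sig j) (xi (nx j))].
  move=> j; have [cj|ncj] := pselect (cc i j); last by exists j.
  have [a aT aP] := domj j; have [_ jn _] := nxP j cj.
  have [a' a'T a'P] := lt_from_lt (sig_lt _ _ jn).
  have aa'T : Order.max a a' < theta by rewrite gt_max aT.
  have [k kl ak] := hg.2 _ aa'T; move: ak; rewrite ge_max => /andP[ak a'k].
  exists k => _; split=> //; last exact: lt_from_le a'P.
  by move=> m cm mj; apply: lt_from_le ak (aP _ _); exists m.
have [k0 k0l Nk] : exists2 k0, k0 < l & ~ ([set j | cc i j /\ k j = k0] #<= below nu0).
  apply: contrapT => no; apply: icard.
  apply: card_le_trans (card_bigcup_le hK (D := below l)
    (F := fun k0 => [set j | cc i j /\ k j = k0]) inu0 (below_mono l_le) _).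
    by apply: subset_card_le => j cj; exists (k j) => //; case: (kP j cj).
  by move=> k0 k0l; apply: contrapT => nk; apply: no; exists k0.
have sig_inc j j' : j < j' -> sig j < sig j'.
  by move=> jj'; apply: lt_trans (sig_lt _ _ jj') (sigP j').2.
have f_inc j j' : cc i j -> cc i j' -> k j = k0 -> k j' = k0 -> j < j' ->
    lt_from (g k0) (sig j) (sig j').
  move=> cj cj' kj kj' jj'; have [cn jn nmin] := nxP j cj.
  have [_ _] := kP j cj; rewrite kj => h1; apply: lt_from_trans h1 _.
  by have [_ h2 _] := kP j' cj'; rewrite -kj'; apply: h2 => //; apply: nmin.
exists (sig @` [set j | cc i j /\ k j = k0]), (g k0); split.
- by move=> _ [j _ <-]; have [] := sigP j.
- move=> Mc; apply: Nk; apply: card_le_trans Mc; apply: (@card_le_inj _ _ _ _ sig).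
    by move=> j Nj; exists j.
  move=> j j' _ _ e1; case: (ltgtP j j') => // /sig_inc; by rewrite e1 ltxx.
- apply: card_le_trans (card_image_le _ _) _; apply: subset_card_le => j [/icl[]] //.
- exact: hg.1.
- move=> m ml ag _ _ [j [cj kj] <-] [j' [cj' kj'] <-] e1.
  case: (ltgtP j j') => [jj'|jj'|-> //].
    by have := f_inc j j' cj cj' kj kj' jj' m ml ag; rewrite e1 ltxx.
  by have := f_inc j' j cj' cj kj' kj jj' m ml ag; rewrite e1 ltxx.
Qed.
End Chain.

Lemma strongly_increasing nu0 (U : set K) : unbounded U -> l <= nu0 -> nu0 < theta ->
  exists M m a, [/\ M `<=` U, ~ (M #<= below nu0), M #<= below m /\ m < theta, a < theta &
    forall i, i < l -> a <= g i -> forall al be, M al -> M be -> f al i = f be i -> al = be].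
Proof.
move=> uU ln0 n0t; have i0 := infinite_below ln0 singular_index_infinite.
(* [nu] is the length of the ladders, [nu1] that of the iteration in club guessing, and [chi] the
   cardinal whose clubs are guessed. *)
pose nu := succ_card nu0; pose nu1 := succ_card nu; pose chi := succ_card nu1.
have n0n : nu0 < nu := lt_succ_card n0t; have nt : nu < theta := succ_card_lt n0t ln0.
have ln : l <= nu := le_trans ln0 (ltW n0n).
have nn1 : nu < nu1 := lt_succ_card nt; have n1t : nu1 < theta := succ_card_lt nt ln.
have ln1 : l <= nu1 := le_trans ln (ltW nn1).
have n1c : nu1 < chi := lt_succ_card n1t; have ct : chi < theta := succ_card_lt n1t ln1.
have i1 := infinite_below (ltW n0n) i0; have i2 := infinite_below (ltW nn1) i1.
have chi_cof b : b < chi -> cof_gt b (below chi).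
  move=> bc D Dc Db; apply: (succ_card_regular n1t i2) => //.
  exact: card_le_trans Db ((succ_cardP n1t).2 b bc).
have [cc ccP] := club_guess hK (succ_card_regular n0t i0)
  (fun j => succ_card_limit n0t i0 (j := j)) (succ_card_regular nt i1)
  (fun j => succ_card_limit nt i1 (j := j)) chi_cof
  (fun j => succ_card_limit n1t i2 (j := j)) (ex_intro _ nu0 n0n) nn1 n1c.
have [M [a [MU Mn Mc aT Mf]]] := strongly_increasing_subset ct
  (fun j => succ_card_limit n1t i2 (j := j)) uU ln0 ccP i0.
by exists M, chi, a.
Qed.
End SingularTheta.

(** * The colouring for singular theta *)

Lemma unbounded_pp_singular (d : Order.disp_t) (K : orderType d) (theta : K) :
  wochoice.well_order (@Order.le d K) -> is_successor_cardinal_of theta ->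
  singular_cardinal theta -> unbounded_pp (full_size_sets K) (complete_ideals K) theta.
Proof.
move=> hK hsucc [htheta [l lt [[g hg] _]]].
have [bot _ hbot'] := ex_least hK (P := [set: K]) (ex_intro _ theta I).
have hbot x : bot <= x by apply: hbot'.
have bt := bot_lt_theta htheta hbot.
have [e [e_lt e_inj]] := injections_into hK hsucc.
have [f [C [cb [Ccl f_lt f_dom]]]] := dominating_sequence hK htheta hbot lt hg e_inj.
have il := singular_index_infinite htheta hbot hg.
pose ii eta b := least theta [set i | i < l /\ e b eta <= g i].
have iiP eta b : eta < b -> ii eta b < l /\ e b eta <= g (ii eta b).
  move=> eb; apply: (leastP hK theta (P := [set i | i < l /\ e b eta <= g i])).
  by have [j jl ej] := hg.2 _ (e_lt b eta eb); exists j.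
(* Below [theta] the constant [bot] keeps the colouring upper-regressive; from [theta] on, every
   colour is below [theta <= b]. *)
pose c eta b := if theta <= b then f b (ii eta b) else bot.
have c_lt eta b : eta < b -> c eta b < theta.
  by move=> eb; rewrite /c; case: ifP => // _; apply: f_lt; case: (iiP eta b eb).
exists c; split=> [//|eta b eb|J A B JJ /(full_size_unbounded hK htheta hsucc) uA posB].
  case: (leP theta b) => [tb|bt']; first exact: lt_le_trans (c_lt eta b eb) tb.
  by rewrite /c leNgt bt' /=; apply: le_lt_trans eb.
apply: contrapT => nex.
(* For an [eta] in [A] outside every [F tau], a greedy choice of colours in [T eta tau] would give
   the injection [h]. *)
pose T eta tau := [set i | i < theta /\ positive J [set b | [/\ B tau b, eta < b & c eta b = i]]].
pose F tau := [set eta | T eta tau #<= below tau].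
have [|tau tt uA'] := unbounded_pigeonhole hK htheta hsucc uA (card_lexx (below theta)) (F := F).
  move=> eta Aeta; apply: contrapT => nF; apply: nex.
  have totlt x y : x <> y -> (x < y \/ y < x :> K) by move=> /eqP; rewrite neq_lt => /orP.
  have [|h [hT hi]] := greedy (D := below theta) (V := T eta) theta (wf_lt hK) totlt.
    move=> tau tt le; apply: nF; exists tau => //; apply: card_le_trans le _.
    by apply: subset_card_le => x [].
  exists eta, h; split=> // [t /hT[]//|x y /set_mem xt /set_mem yt|t /hT[]//].
  exact: hi.
have [X [XA Xi]] := unbounded_inj hK htheta hsucc uA'.
have [ep epP] := kappa_bound hK htheta hsucc X (card_lexx (below theta)).
(* At most theta pairs are null, so their fibres can be removed from [B tau]; for [b] in the
   resulting [U], every [c (X i) b] is in [T (X i) tau]. *)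
pose D := [set p : K * K | [/\ p.1 < theta, p.2 < theta & ~ T (X p.1) tau p.2]].
pose N p := [set b | [/\ B tau b, X p.1 < b & c (X p.1) b = p.2]].
have Dt : D #<= below theta.
  apply: card_le_trans (card_sqr hK htheta.2).
  by apply: subset_card_le => p [].
have DN p : D p -> J (N p).
  by move=> [p1 p2 nT]; apply: contrapT => nJ; apply: nT.
have uU := positive_unbounded JJ
  (positive_avoid hsucc (e := Order.max ep theta) JJ (posB tau tt) Dt DN).
set U := [set b | _] in uU.
have UP b i : U b -> i < theta -> [/\ X i < b, theta <= b & T (X i) tau (c (X i) b)].
  case=> Bb; rewrite gt_max => /andP[eb tb] nN it.
  have Xb : X i < b by apply: lt_trans (epP i it) eb.
  split=> //; first exact: ltW.
  apply: contrapT => nT; apply: (nN (i, c (X i) b)) => //.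
  by split=> //=; apply: c_lt.
pose nu0 := Order.max tau l; have n0t : nu0 < theta by rewrite gt_max lt andbT.
have ln0 : l <= nu0 by rewrite le_max lexx orbT.
have tn0 : tau <= nu0 by rewrite le_max lexx.
have [M [m [a [MU Mn [Mm mt] aT Mf]]]] :=
  strongly_increasing hK htheta hsucc hbot hg e_lt Ccl f_dom uU ln0 n0t.
(* If some [X i] had index at least [a] at every [b] in [M], then [b] would be determined by
   [ii (X i) b] and the colour, as [f] is injective on [M] there. This embeds [M] into a product of
   size at most [nu0]. *)
have /exists_choice[bs bsP] : forall i, exists b, i < theta -> M b /\ e b (X i) < a.
  move=> i; apply: contrapT => no; apply: Mn.
  have it : i < theta by apply: contrapT => nit; apply: no; exists theta.
  apply: card_le_trans (card_setX_le hK (infinite_below ln0 il) (below_mono ln0)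
    (card_le_trans (XA i it).2 (below_mono tn0))).
  apply: (@card_le_inj _ _ _ _ (fun b => (ii (X i) b, c (X i) b))).
    by move=> b /MU/UP-/(_ i it)[Xb _ Tc]; split=> //=; case: (iiP (X i) b Xb).
  move=> b b' Mb Mb' [ebb cbb].
  have [Xb tb _] := UP b i (MU b Mb) it; have [_ tb' _] := UP b' i (MU b' Mb') it.
  have [ilt eg] := iiP (X i) b Xb.
  apply: (Mf _ ilt) => //; last by move: cbb; rewrite /c tb tb' -ebb.
  apply: le_trans eg; rewrite leNgt; apply/negP => ea.
  by apply: no; exists b.
(* The pair of [bs i] and the index of [X i] there determines [i], which embeds theta into a product
   of size at most [w]. *)
pose w := Order.max (Order.max m a) l.
have wt : w < theta by rewrite !gt_max mt aT lt.
have iw : infinite_set (below w) by apply: infinite_below il; rewrite le_max lexx orbT.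
apply: (cardinal_nle htheta wt).
apply: card_le_trans (card_setX_le hK iw (A := M) (B := below a) _ _).
- apply: (@card_le_inj _ _ _ _ (fun i => (bs i, e (bs i) (X i)))) => [i /bsP[]//|i j it jt [bij eij]].
  have [Mi _] := bsP i it; have [Xb _ _] := UP _ i (MU _ Mi) it.
  have [Xb' _ _] := UP _ j (MU _ Mi) jt.
  apply: Xi => //; rewrite -bij in eij; exact: e_inj Xb Xb' eij.
- by apply: card_le_trans Mm (below_mono _); rewrite !le_max lexx.
- by apply: below_mono; rewrite !le_max lexx orbT.
Qed.

Theorem corollary5p5 (d : Order.disp_t) (K : orderType d) (theta : K)
    (hK : wochoice.well_order (@Order.le d K))
    (htheta : infinite_cardinal theta)
    (hsucc : is_successor_cardinal_of theta) :
  (regular_cardinal theta ->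
     onto_pp (full_size_sets K) (complete_ideals K) theta) /\
  (singular_cardinal theta ->
     unbounded_pp (full_size_sets K) (complete_ideals K) theta).
Proof.
by split; [apply: onto_pp_regular|apply: unbounded_pp_singular].
Qed.
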